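(* If $\sigma$ is a non-isotropic, symmetric, positive definite, constant $2\times2$ matrix, then there exists no isotropic $\gamma\in E_\sigma$.
   Context: $\Omega$ is a bounded convex subset of $\mathbb{R}^2$ with $C^2$ boundary. A matrix field is isotropic if it is of the form $a(x)I_2$ with $a$ scalar. For a diffeomorphism $F:\Omega\to\Omega$ write $$F_*\sigma:=\frac{(\nabla F)^T\sigma\nabla F}{\det(\nabla F)}\circ F^{-1},\qquad (\nabla F)_{ij}=\partial_iF_j.$$ $\Sigma(\Omega)$ is the set of symmetric $\sigma\in L^\infty(\Omega;\mathbb{R}^{2\times2})$ that are uniformly elliptic and bounded, and $$E_\sigma=\{\sigma_1\in\Sigma(\Omega)\mid\sigma_1=F_*\sigma,\ F:\Omega\to\Omega\text{ an }H^1\text{-diffeomorphism with }F|_{\partial\Omega}=x\}.$$ *)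

(* Defs.v *)
From mathcomp Require Import all_boot all_order all_algebra.
From mathcomp Require Import all_classical all_reals all_analysis.
Set Implicit Arguments.
Unset Strict Implicit.
Unset Printing Implicit Defensive.
Import Order.TTheory GRing.Theory Num.Theory.
Import numFieldNormedType.Exports.
Local Open Scope classical_set_scope.
Local Open Scope ring_scope.

(* The plane is R * R, so that product topology, Borel sets and product
   measure are the library's. *)
Notation leb2 R := (@lebesgue_measure R \x @lebesgue_measure R)%E.

Definition pcoord (R : realType) (i : 'I_2) (x : R * R) : R :=
  if i == 0 then x.1 else x.2.

Definition basis2 (R : realType) (i : 'I_2) : R * R :=
  ((i == 0)%:R, (i == 1)%:R).

Arguments basis2 R i : clear implicits.

Definition pderiv (R : realType) (i : 'I_2) (f : R * R -> R) (x : R * R) : R :=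
  'D_(basis2 R i) f x.

Fixpoint Ck (R : realType) (U : set (R * R)) (k : nat) (f : R * R -> R) : Prop :=
  (forall x, U x -> {for x, continuous f}) /\
  if k is k'.+1 then
    forall i, (forall x, U x -> derivable f x (basis2 R i)) /\
              Ck U k' (pderiv i f)
  else True.

Definition boundary (R : realType) (A : set (R * R)) : set (R * R) :=
  closure A `\` interior A.

(* Local C^2 defining functions with nonvanishing gradient; by the implicit
   function theorem, Omega lies locally on one side of a C^2 graph. *)
Definition C2_boundary (R : realType) (Omega : set (R * R)) : Prop :=
  forall p, boundary Omega p ->
    exists (U : set (R * R)) (rho : R * R -> R),
      [/\ open U, U p, Ck U 2 rho,
          exists i, pderiv i rho p != 0 &
          Omega `&` U = [set x | rho x < 0] `&` U].

Definition test_function (R : realType) (Omega : set (R * R))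
    (phi : R * R -> R) : Prop :=
  (forall k, Ck setT k phi) /\
  exists K : set (R * R),
    [/\ compact K, K `<=` Omega & forall x, ~ K x -> phi x = 0].

(* Norm of L^p(Omega); the function is extended by 0 outside Omega. *)
Definition Lnorm_on (R : realType) (Omega : set (R * R)) (p : \bar R)
    (u : R * R -> R) : \bar R :=
  ('N[leb2 R]_p[EFin \o (u \_ Omega)])%E.

Definition Lp_on (R : realType) (Omega : set (R * R)) (p : \bar R)
    (u : R * R -> R) : Prop :=
  measurable_fun (Omega : set (measurableTypeR R * measurableTypeR R)) u /\
  (Lnorm_on Omega p u < +oo)%E.

Definition weak_gradient (R : realType) (Omega : set (R * R))
    (u : R * R -> R) (g : 'I_2 -> R * R -> R) : Prop :=
  forall i, Lp_on Omega 2%:E (g i) /\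
    forall phi, test_function Omega phi ->
      \int[leb2 R]_(x in Omega) (u x * pderiv i phi x) =
      - \int[leb2 R]_(x in Omega) (g i x * phi x).

Definition H1 (R : realType) (Omega : set (R * R)) (u : R * R -> R) : Prop :=
  Lp_on Omega 2%:E u /\ exists g, weak_gradient Omega u g.

(* Closure of the test functions in the H^1 norm. *)
Definition H10 (R : realType) (Omega : set (R * R)) (u : R * R -> R) : Prop :=
  Lp_on Omega 2%:E u /\
  exists2 g, weak_gradient Omega u g &
  exists phi : nat -> R * R -> R,
    [/\ forall n, test_function Omega (phi n),
        Lnorm_on Omega 2%:E (fun x => phi n x - u x) @[n --> \oo] --> 0%E &
        forall i, Lnorm_on Omega 2%:E (fun x => pderiv i (phi n) x - g i x)
                    @[n --> \oo] --> 0%E].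

(* pinv Omega F is the inverse of the bijection F from Omega to Omega. *)
Definition H1_diffeo (R : realType) (Omega : set (R * R))
    (F : R * R -> R * R) : Prop :=
  [/\ set_bij Omega Omega F,
      {within Omega, continuous F},
      {within Omega, continuous (pinv Omega F)},
      forall j, H1 Omega (pcoord j \o F) &
      forall j, H1 Omega (pcoord j \o pinv Omega F)].

(* F = x on the boundary, in the sense of traces of H^1 functions. *)
Definition boundary_id (R : realType) (Omega : set (R * R))
    (F : R * R -> R * R) : Prop :=
  forall j, H10 Omega (fun x => pcoord j (F x) - pcoord j x).

(* (DF x) i j is the i-th derivative of the j-th component of F. *)
Definition weak_jacobian (R : realType) (Omega : set (R * R))
    (F : R * R -> R * R) (DF : R * R -> 'M[R]_2) : Prop :=
  forall j, weak_gradient Omega (pcoord j \o F) (fun i x => DF x i j).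

Definition pushforward (R : realType) (Omega : set (R * R))
    (F : R * R -> R * R) (DF sigma : R * R -> 'M[R]_2) : R * R -> 'M[R]_2 :=
  (fun x => (\det (DF x))^-1 *: ((DF x)^T *m sigma x *m DF x))
    \o pinv Omega F.

Definition qform (R : realType) (A : 'M[R]_2) (xi : 'cV[R]_2) : R :=
  (xi^T *m A *m xi) 0 0.

Definition Sigma (R : realType) (Omega : set (R * R))
    (sigma : R * R -> 'M[R]_2) : Prop :=
  [/\ forall i j, Lp_on Omega +oo%E (fun x => sigma x i j),
      {ae leb2 R, forall x, Omega x -> (sigma x)^T = sigma x} &
      exists lambda Lambda : R, 0 < lambda /\
        {ae leb2 R, forall x, Omega x -> forall xi : 'cV[R]_2,
          lambda * qform 1%:M xi <= qform (sigma x) xi <=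
          Lambda * qform 1%:M xi}].

Definition E_class (R : realType) (Omega : set (R * R))
    (sigma sigma1 : R * R -> 'M[R]_2) : Prop :=
  Sigma Omega sigma1 /\
  exists (F : R * R -> R * R) (DF : R * R -> 'M[R]_2),
    [/\ H1_diffeo Omega F, boundary_id Omega F, weak_jacobian Omega F DF &
        {ae leb2 R, forall y, Omega y ->
          sigma1 y = pushforward Omega F DF sigma y}].

Definition isotropic (R : realType) (Omega : set (R * R))
    (gamma : R * R -> 'M[R]_2) : Prop :=
  exists a : R * R -> R,
    {ae leb2 R, forall x, Omega x -> gamma x = (a x)%:M}.

Definition posdef (R : realType) (A : 'M[R]_2) : Prop :=
  forall xi : 'cV[R]_2, xi != 0 -> 0 < qform A xi.

(* Main.v *)
Require Import Defs.
From mathcomp Require Import all_boot all_order all_algebra.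
From mathcomp Require Import all_classical all_reals all_analysis.
From mathcomp Require Import measurable_realfun.
From mathcomp Require Import ring lra.
Set Implicit Arguments.
Unset Strict Implicit.
Unset Printing Implicit Defensive.
Import Order.TTheory GRing.Theory Num.Theory.
Import numFieldNormedType.Exports.
Local Open Scope classical_set_scope.
Local Open Scope ring_scope.

(** Let [F] be an admissible map for which the pushforward of [sigma] is
    isotropic, with gradient matrix [DF], and put [s = sqrt (det sigma)]. Where
    the pushforward is [g] times the identity,
    [DF^T sigma DF = g det(DF) I]. Taking determinants gives [g = s], and then
    [DF] satisfies two linear equations with constant coefficients, the
    Cauchy-Riemann equations twisted by [sigma] ([cauchy_riemann]). Linear
    equations survive averaging, and the mean of [DF] over [Omega] is the
    identity matrix because [F] and the identity have the same boundary values
    ([integral_gradient]). So the identity matrix satisfies the twisted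
    equations, which forces [sigma] to be a multiple of the identity.

    What remains is that the pushforward is known at [y = F x] for almost every
    [y], whereas the average runs over [x]. The zero matrix solves the linear
    equations too, so it is enough that [DF = 0] almost everywhere on the
    preimage of a null set ([gradient_null_preimage]). This comes from the
    inverse [G] of [F] being weakly differentiable: [F] transports the form
    [dx_i /\ dF_j] to [d_m G_i dy] up to sign, with [m] the index other than [j]
    ([pushforward_coord_wedge]). Hence the integral of [dx_i /\ dF_j] over any
    part [A] of the preimage of a null set is an integral over [F(A)], which is
    null.

    The transport formula is obtained by approximation. The boundary condition
    makes [F] a limit in [H^1] of smooth maps [f_n] equal to the identity off a
    compact subset of [Omega]. Jacobians of pairs of functions are divergences
    ([integral_wedge0]), which gives for smooth [psi] and [phi] with compact
    support, the second one by integrating [d(x_i phi(f_n) df_(n,j))],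
    [[
      int psi(f_n) det(Df_n) = int psi,
      int x_i (d_m phi)(f_n) det(Df_n) = +- int phi(f_n) dx_i /\ df_(n,j).
    ]]
    Both pass to the limit: a Jacobian is a bilinear expression in gradients
    that converge in [L^2], so it converges in [L^1], and the other factors are
    bounded and converge in mean ([cvg_int_tensor]). The first formula for
    [F] extends to bounded Borel functions ([integral_jacobian]); for the
    function [G_i d_m phi] it turns the left-hand side of the second one into
    [int G_i d_m phi], that is, [- int phi d_m G_i].

    The functions [psi] and [phi] are products [alpha(y_1) beta(y_2)] of smooth
    approximations of indicators of intervals. This is enough to reach all
    bounded Borel functions ([same_bounded]), and it makes [psi(f) det(Df)] the
    Jacobian of [(A(f_1), S(f_2))], with [A] and [S] primitives of [alpha] and
    [beta]. *)

(** * Functions that are k times continuously differentiable *)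

(** The directions [e] are a parameter so that one theory serves functions on
    the plane, with the canonical basis, and functions of one variable, with the
    direction 1. *)
Fixpoint Cdir (R : realType) (V : normedModType R) (I : Type) (e : I -> V)
    (k : nat) (f : V -> R) : Prop :=
  continuous f /\
  if k is k'.+1 then
    forall i, (forall x, derivable f x (e i)) /\ Cdir e k' ('D_(e i) f)
  else True.

Section Cdir.
Context (R : realType) (V : normedModType R) (I : Type) (e : I -> V).
Implicit Types f g : V -> R.

Lemma CdirW k f : Cdir e k.+1 f -> Cdir e k f.
Proof.
elim: k f => [|k IH] f; first by case.
move=> [cf df]; split=> // i; have [d1 d2] := df i; split=> //; exact: IH.
Qed.

Lemma Cdir_continuous k f : Cdir e k f -> continuous f.
Proof. by case: k => [|k] []. Qed.

Lemma Cdir_cst k (c : R) : Cdir e k (cst c).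
Proof.
elim: k c => [|k IH] c; (split; first by move=> x; exact: cvg_cst) => // i.
split; first by move=> x; exact: derivable_cst.
rewrite (_ : 'D_(e i) _ = cst 0) //.
by apply/funext => x; rewrite derive_cst.
Qed.

Lemma CdirD k f g : Cdir e k f -> Cdir e k g -> Cdir e k (f \+ g).
Proof.
elim: k f g => [|k IH] f g [cf df] [cg dg].
  by split=> // x; apply: cvgD; [exact: cf|exact: cg].
split; first by move=> x; apply: cvgD; [exact: cf|exact: cg].
move=> i; have [df1 df2] := df i; have [dg1 dg2] := dg i.
split; first by move=> x; apply: derivableD.
rewrite (_ : 'D_(e i) (f \+ g) = 'D_(e i) f \+ 'D_(e i) g); first exact: IH.
by apply/funext => x; rewrite deriveD.
Qed.

Lemma CdirM k f g : Cdir e k f -> Cdir e k g -> Cdir e k (f \* g).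
Proof.
elim: k f g => [|k IH] f g Cf Cg; have [cf df] := Cf; have [cg dg] := Cg.
  by split=> // x; apply: cvgM; [exact: cf|exact: cg].
split; first by move=> x; apply: cvgM; [exact: cf|exact: cg].
move=> i; have [df1 df2] := df i; have [dg1 dg2] := dg i.
split; first by move=> x; apply: derivableM.
rewrite (_ : 'D_(e i) (f \* g) = (f \* 'D_(e i) g) \+ (g \* 'D_(e i) f)).
  by apply: CdirD; apply: IH => //; exact: CdirW.
by apply/funext => x; rewrite deriveM.
Qed.

Lemma CdirB k f g : Cdir e k f -> Cdir e k g -> Cdir e k (f \- g).
Proof.
move=> Cf Cg; have -> : f \- g = f \+ (cst (-1) \* g).
  by apply/funext => x /=; rewrite mulN1r.
by apply: CdirD => //; apply: CdirM => //; exact: Cdir_cst.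
Qed.

End Cdir.

Notation unitdir R := (fun _ : unit => (1 : R)).

Section chain.
Context (R : realType) (V : normedModType R).

Lemma is_derive_line (f : V -> R) x v : derivable f x v ->
  is_derive (0 : R) (1 : R) (fun h : R => f (h *: v + x)) ('D_v f x).
Proof.
move=> df; apply: DeriveDef; first by have /derivable1P := df.
rewrite /derive.
set g1 := fun h => h^-1 *: _; set g2 := fun h => h^-1 *: _.
suff -> : g1 = g2 by [].
apply/funext => h; rewrite /g1 /g2 /=.
by rewrite addr0 scale0r add0r [_%:A]mulr1.
Qed.

(** Only differentiability along the direction [v] is asked of the inner
    function, so the rule applies to partial derivatives. *)
Lemma derive_comp_dir (a : R -> R) (f : V -> R) x v :
  derivable a (f x) 1 -> derivable f x v ->
  derivable (a \o f) x v /\ 'D_v (a \o f) x = 'D_1 a (f x) * 'D_v f x.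
Proof.
move=> da df; have [dl Dl] := is_derive_line df.
have da' : derivable a ((fun h : R => f (h *: v + x)) 0) 1.
  by rewrite /= scale0r add0r.
have d : derivable (fun h : R => (a \o f) (h *: v + x)) 0 1.
  apply/derivable1_diffP; apply: (@differentiable_comp _ _ _ _ (fun h : R => f (h *: v + x)) a).
    by move/derivable1_diffP : dl.
  by move/derivable1_diffP : da'.
have dc : derivable (a \o f) x v by exact: (derivable1P _ _ _).2.
split=> //.
have [_ <-] := is_derive_line dc.
rewrite -derive1E (derive1_comp dl da') /= !derive1E Dl.
by rewrite scale0r add0r.
Qed.

Lemma Cdir_comp (I : Type) (e : I -> V) k (a : R -> R) (f : V -> R) :
  Cdir (unitdir R) k a -> Cdir e k f -> Cdir e k (a \o f).
Proof.
elim: k a f => [|k IH] a f Ca Cf; have [ca da] := Ca; have [cf df] := Cf.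
  by split=> // x; apply: continuous_comp; [exact: cf|exact: ca].
split; first by move=> x; apply: continuous_comp; [exact: cf|exact: ca].
move=> i; have [da1 da2] := da tt; have [df1 df2] := df i.
split; first by move=> x; have [] := derive_comp_dir (da1 (f x)) (df1 x).
rewrite (_ : 'D_(e i) (a \o f) = ('D_1 a \o f) \* 'D_(e i) f).
  by apply: CdirM => //; apply: IH => //; exact: CdirW.
by apply/funext => x /=; have [_ ->] := derive_comp_dir (da1 (f x)) (df1 x).
Qed.

End chain.

Section plane.
Context (R : realType).
Implicit Types (f g : R * R -> R).

Lemma CkE k f : Ck setT k f <-> Cdir (basis2 R) k f.
Proof.
elim: k f => [|k IH] f /=.
  by split=> -[cf _]; split=> // x; [exact: cf|move=> _; exact: cf].
split=> -[cf df]; (split; first by [move=> x; exact: cf|move=> x _; exact: cf]) => i;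
  have [d1 d2] := df i; (split; first by [move=> x; exact: d1|move=> x _; exact: d1]);
  exact/IH.
Qed.

Lemma derive_pcoord i (x v : R * R) :
  derivable (@pcoord R i) x v /\ 'D_v (@pcoord R i) x = pcoord i v.
Proof.
have h : (fun h : R => h^-1 *: (pcoord i (h *: v + x) - pcoord i x)) @ (0 : R)^'
    --> pcoord i v.
  apply: (@cvg_trans _ ((cst (pcoord i v) : R -> R) @ (0 : R)^')); last exact: cvg_cst.
  apply: near_eq_cvg; near=> h.
  have h0 : h != 0 by near: h; exact: nbhs_dnbhs_neq.
  have -> : pcoord i (h *: v + x) = h * pcoord i v + pcoord i x.
    by rewrite /pcoord; case: ifP.
  by rewrite addrK /= /GRing.scale /= mulrA mulVf // mul1r.
split; first by apply/cvg_ex; exists (pcoord i v).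
exact/cvg_lim.
Unshelve. all: by end_near. Qed.

Lemma pcoord_continuous i : continuous (@pcoord R i).
Proof.
rewrite /pcoord; case: (i == 0) => x; [exact: cvg_fst|exact: cvg_snd].
Qed.

Lemma pcoord_basis2 i j : pcoord i (basis2 R j) = (i == j)%:R.
Proof. by case: i => -[|[|//]] ?; case: j => -[|[|//]] ?. Qed.

Lemma pderiv_pcoord i j : pderiv j (@pcoord R i) = cst (i == j)%:R.
Proof.
apply/funext => x; rewrite /pderiv.
by have [_ ->] := derive_pcoord i x (basis2 R j); rewrite pcoord_basis2.
Qed.

Lemma Cdir_pcoord k i : Cdir (basis2 R) k (@pcoord R i).
Proof.
case: k => [|k]; (split; first exact: pcoord_continuous) => // j.
split; first by move=> x; have [] := derive_pcoord i x (basis2 R j).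
have := pderiv_pcoord i j; rewrite /pderiv => H.
by rewrite H; exact: Cdir_cst.
Qed.

End plane.

(** * A smooth approximation of the indicator of an interval *)

Section flat.
Context (R : realType).
Implicit Types (t : R) (m : nat).

(** The powers of [t] are there to make the family stable under
    differentiation, up to linear combinations: all its members are then smooth
    by one induction. *)
Definition flat m t : R := if 0 < t then t ^- m * expR (- t^-1) else 0.

Lemma flat_le0 m t : t <= 0 -> flat m t = 0.
Proof. by rewrite /flat ltNge => ->. Qed.

(** A quadratic bound makes the derivative at 0 exist and vanish. It comes from
    the term of degree [m.+2] of the exponential series at [t^-1]. *)
Lemma flat_quadratic m t : 0 <= flat m t <= (m.+2)`!%:R * t ^+ 2.
Proof.
rewrite /flat; case: ltP => t0; last first.
  by rewrite lexx mulr_ge0 // sqr_ge0.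
apply/andP; split; first by rewrite mulr_ge0 ?expR_ge0 // invr_ge0 exprn_ge0 // ltW.
have ti0 : 0 < t^-1 by rewrite invr_gt0.
have /= := expR_ge1Dxn m.+1 (ltW ti0).
have f0 : 0 < (m.+2)`!%:R :> R by rewrite ltr0n fact_gt0.
move=> H; have {}H : t^-1 ^+ m.+2 / (m.+2)`!%:R <= expR t^-1.
  by apply: le_trans H; rewrite lerDr.
rewrite expRN.
rewrite ler_pdivrMr ?expR_gt0 //.
apply: le_trans (ler_wpM2l _ H); last by rewrite mulr_ge0 // sqr_ge0.
rewrite [leRHS](_ : _ = t ^- m) //.
have tn : t != 0 by rewrite gt_eqF.
rewrite exprVn -addn2 exprD invfM.
field.
by rewrite tn expf_neq0 //= gt_eqF.
Qed.

Lemma derive_flat m t :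
  derivable (flat m) t 1 /\ 'D_1 (flat m) t = - m%:R * flat m.+1 t + flat m.+2 t.
Proof.
suff : is_derive t (1 : R) (flat m) (- m%:R * flat m.+1 t + flat m.+2 t).
  by move=> [].
have [t0|t0|->] := ltrgtP t 0.
- apply: (@near_eq_is_derive _ _ _ (cst 0)).
  + near=> s; rewrite flat_le0 // ltW //; near: s.
    exact: lt_nbhsl.
  + rewrite !flat_le0 ?ltW // mulr0 addr0; exact: is_derive_cst.
- apply: (@near_eq_is_derive _ _ _ (fun s : R => s ^- m * expR (- s^-1))).
  + near=> s; rewrite /flat ifT //; near: s.
    exact: lt_nbhsr.
  + have tn : t != 0 by rewrite gt_eqF.
    have dV : is_derive t (1 : R) (fun s : R => s^-1) (- t ^- 2).
      have := is_deriveV tn (is_derive_id t (1 : R)).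
      by rewrite /GRing.scale /= mulr1.
    have dE : is_derive t (1 : R) (fun s : R => expR (- s^-1)) (t ^- 2 * expR (- t^-1)).
      have := @is_derive1_comp _ expR (fun s : R => - s^-1) t _ _ (is_derive_expR (- t^-1)) (is_deriveN dV).
      by rewrite opprK mulrC.
    have dX : is_derive t (1 : R) (fun s : R => s ^- m) (- m%:R * t ^- m.+1).
      have := is_deriveX m dV.
      have -> : (fun s : R => s^-1) ^+ m = (fun s : R => s ^- m).
        by apply/funext => s; rewrite exprfctE exprVn.
      move=> H; apply: (is_derive_eq H).
      case: (m) => [|k] /=; first by rewrite !mul0r oppr0 mul0r scale0r.
      by rewrite /GRing.scale /= -!exprVn !exprS; ring.
    have dM := is_deriveM dX dE.
    apply: (is_derive_eq dM).
    by rewrite /flat t0 /GRing.scale /= -!exprVn !exprS; ring.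
- rewrite !flat_le0 // mulr0 addr0.
  suff h : (fun h : R => h^-1 *: (flat m (h *: 1 + 0) - flat m 0)) @ (0 : R)^' --> (0 : R).
    apply: DeriveDef; first by apply/cvg_ex; exists 0.
    exact/cvg_lim.
  pose C : R := (m.+2)`!%:R.
  have C0 : 0 < C by rewrite ltr0n fact_gt0.
  apply/cvgrPdist_le => eps eps0; near=> h.
  have h0 : h != 0 by near: h; exact: nbhs_dnbhs_neq.
  rewrite addr0 [flat m 0]flat_le0 // subr0 sub0r normrN /GRing.scale /= mulr1.
  have /andP[f0 f1] := flat_quadratic m h.
  rewrite normrM normfV (ger0_norm f0) mulrC ler_pdivrMr ?normr_gt0 //.
  apply: le_trans f1 _.
  rewrite -real_normK ?num_real // expr2 mulrA ler_wpM2r // -ler_pdivlMl //.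
  near: h; apply: dnbhs0_le; rewrite mulr_gt0 ?invr_gt0.
Unshelve. all: by end_near. Qed.

Lemma Cdir_flat k m : Cdir (unitdir R) k (flat m).
Proof.
have cf p : continuous (flat p).
  move=> t; apply: differentiable_continuous; apply/derivable1_diffP.
  by have [] := derive_flat p t.
elim: k m => [|k IH] m; (split; first exact: cf) => // _.
split; first by move=> t; have [] := derive_flat m t.
rewrite (_ : 'D_1 (flat m) = (cst (- m%:R) \* flat m.+1) \+ flat m.+2).
  by apply: CdirD => //; apply: CdirM => //; exact: Cdir_cst.
by apply/funext => t; have [_ ->] := derive_flat m t.
Qed.

Lemma Cdir_id k : Cdir (unitdir R) k (@id R).
Proof.
case: k => [|k]; (split; first by move=> x; exact: cvg_id) => // _.
split; first by move=> x; exact: derivable_id.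
have -> : 'D_(1 : R) (@id R) = cst (1 : R) by apply/funext => x; rewrite derive_id.
exact: Cdir_cst.
Qed.

(** The two factors steepen with [n] while their product keeps vanishing off
    the interval from [a] to [b], whose indicator is the limit. *)
Definition plateau n (a b t : R) : R :=
  flat 0 (n.+1%:R * (t - a)) * flat 0 (n.+1%:R * (b - t)).

Lemma Cdir_plateau k n a b : Cdir (unitdir R) k (plateau n a b).
Proof.
have aff (c d : R) : Cdir (unitdir R) k (fun t => c * t + d).
  apply: (@CdirD _ _ _ _ _ (fun t => c * t) (cst d)); last exact: Cdir_cst.
  apply: (@CdirM _ _ _ _ _ (cst c) id); [exact: Cdir_cst|exact: Cdir_id].
rewrite (_ : plateau n a b = (flat 0 \o (fun t => n.+1%:R * t + (- n.+1%:R * a))) \*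
                      (flat 0 \o (fun t => - n.+1%:R * t + n.+1%:R * b))).
  by apply: CdirM; apply: Cdir_comp => //; exact: Cdir_flat.
by apply/funext => t; rewrite /plateau /=; congr (flat _ _ * flat _ _); ring.
Qed.

Lemma flat_ge0_le1 t : 0 <= flat 0 t <= 1.
Proof.
rewrite /flat; case: ltP => t0; last by rewrite lexx ler01.
by rewrite expr0 invr1 mul1r expR_ge0 expR_le1 oppr_le0 invr_ge0 ltW.
Qed.

Lemma plateau_ge0_le1 n a b t : 0 <= plateau n a b t <= 1.
Proof.
have /andP[p0 p1] := flat_ge0_le1 (n.+1%:R * (t - a)).
have /andP[q0 q1] := flat_ge0_le1 (n.+1%:R * (b - t)).
by rewrite /plateau mulr_ge0 // mulr_ile1.
Qed.

Lemma plateau_out n a b t : ~ `]a, b[%classic t -> plateau n a b t = 0.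
Proof.
rewrite /= in_itv /= => /negP; rewrite negb_and -!leNgt => /orP[h|h].
  by rewrite /plateau flat_le0 ?mul0r // pmulr_rle0 // subr_le0.
by rewrite /plateau [X in _ * X]flat_le0 ?mulr0 // pmulr_rle0 // subr_le0.
Qed.

Lemma plateau_out_cc n a b t : ~ `[a, b]%classic t -> plateau n a b t = 0.
Proof.
move=> h; apply: plateau_out; apply: contra_not h.
by rewrite /= !in_itv /= => /andP[/ltW -> /ltW ->].
Qed.

Lemma flat_cvg t : (fun n => flat 0 (n.+1%:R * t)) @ \oo --> (\1_(`]0, +oo[%classic) t : R).
Proof.
rewrite indicE; have [t0|t0] := leP t 0.
  rewrite memNset /=; last by rewrite in_itv /= andbT ltNge t0.
  rewrite (_ : (fun n => _) = cst 0); first exact: cvg_cst.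
  by apply/funext => n; rewrite flat_le0 // pmulr_rle0.
rewrite mem_set /=; last by rewrite in_itv /= andbT.
rewrite (_ : (fun n => _) = (fun n => expR (- (harmonic n * t^-1)))); last first.
  apply/funext => n; rewrite /flat pmulr_rgt0 // t0 expr0 invr1 mul1r.
  by rewrite invfM.
rewrite -[X in _ --> X](@expR0 R).
apply: (cvg_comp (fun n : nat => - (harmonic n * t^-1)) (@expR R)); last exact: continuous_expR.
have : (fun n : nat => - (harmonic n * t^-1)) @ \oo --> - (0 * t^-1).
  by apply: cvgN; apply: cvgM; [exact: cvg_harmonic|exact: cvg_cst].
by rewrite mul0r oppr0.
Qed.

Lemma plateau_cvg a b t : (fun n => plateau n a b t) @ \oo --> (\1_(`]a, b[%classic) t : R).
Proof.
rewrite (_ : \1_(`]a, b[%classic) t =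
    \1_(`]0, +oo[%classic) (t - a) * \1_(`]0, +oo[%classic) (b - t) :> R).
  by apply: cvgM; exact: flat_cvg.
by rewrite !indicE -natrM mulnb; congr (_%:R); congr nat_of_bool;
   rewrite !mem_setE !in_itv /= !andbT !subr_gt0.
Qed.

End flat.

Section one_variable.
Context (R : realType).
Implicit Types (a : R -> R).

Lemma CdirS_primitive k (A a : R -> R) : Cdir (unitdir R) k a ->
  (forall t, is_derive t (1 : R) A (a t)) -> Cdir (unitdir R) k.+1 A.
Proof.
move=> Ca dA; split=> [t|_].
  by apply/differentiable_continuous/derivable1_diffP; have [] := dA t.
split=> [t|]; first by have [] := dA t.
suff -> : 'D_1 A = a by [].
by apply/funext => t; have [] := dA t.
Qed.

(** Compact support makes the integral from [-oo] to [t] finite. *)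
Lemma exists_primitive a (c d : R) : continuous a ->
  (forall t, ~ `[c, d]%classic t -> a t = 0) ->
  exists A : R -> R, forall t, is_derive t (1 : R) A (a t).
Proof.
move=> ca a0.
have icd : (@lebesgue_measure R).-integrable `[c, d] (EFin \o a).
  by apply: continuous_compact_integrable; [exact: segment_compact|exact: continuous_subspaceT].
have iT : (@lebesgue_measure R).-integrable setT (EFin \o a).
  have mcd : measurable (`[c, d]%classic : set (measurableTypeR R)) by exact: measurable_itv.
  have := icd; move=> /(integrable_mkcond _ mcd).
  congr (is_true (_.-integrable _ _)); apply/funext => t; rewrite patchE /=.
  by case: ifPn => // /negP tn; rewrite a0 // => tcd; apply: tn; rewrite inE.
pose A t := \int[@lebesgue_measure R]_(s in `]-oo, t]%classic) a s.
exists A => t.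
have iu : (@lebesgue_measure R).-integrable `]-oo, (t + 1)%R]%classic (EFin \o a).
  by apply: integrableS iT => //; exact: measurable_itv.
have tt1 : t < t + 1 by rewrite ltrDl.
have [dA DA] := continuous_FTC1 tt1 iu (ltNyr _) (ca t).
apply: DeriveDef; first exact: dA.
exact: (etrans (esym (derive1E A t)) DA).
Qed.

Lemma derive_out a (c d : R) : (forall t, ~ `[c, d]%classic t -> a t = 0) ->
  forall t, ~ `[c, d]%classic t -> 'D_1 a t = 0.
Proof.
move=> a0 t nt; rewrite (@near_eq_derive _ _ _ a (cst 0)) ?derive_cst //.
have oK : open (~` `[c, d]%classic) by apply: closed_openC; exact: interval_closed.
by apply: (filterS _ (oK t nt)) => y /a0 ->.
Qed.

(** The Lipschitz bound carries convergence in mean of a sequence of functions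
    over to their compositions with [a]; the bound on [a] makes these
    compositions admissible factors in [cvg_int_mul]. *)
Definition bounded_lipschitz (a : R -> R) := exists C : R,
  (forall t, `|a t| <= C) /\ (forall s t, `|a s - a t| <= C * `|s - t|).

Lemma C1_bounded_lipschitz a (c d : R) : Cdir (unitdir R) 1 a ->
  (forall t, ~ `[c, d]%classic t -> a t = 0) -> bounded_lipschitz a.
Proof.
move=> Ca a0; have [ca /(_ tt)[da [cda _]]] := Ca.
have bnd (f : R -> R) : continuous f -> (forall t, ~ `[c, d]%classic t -> f t = 0) ->
    exists2 C : R, 0 <= C & forall t, `|f t| <= C.
  move=> cf f0; have : compact (f @` `[c, d]).
    by apply: continuous_compact; [exact: continuous_subspaceT|exact: segment_compact].
  move=> /compact_bounded[M [_ HM]]; exists (`|M| + 1); first by rewrite addr_ge0.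
  move=> t; have [tcd|/f0 ->] := pselect (`[c, d]%classic t); last by rewrite normr0 addr_ge0.
  by apply: HM; [rewrite (le_lt_trans (ler_norm _)) // ltrDl|exists t].
have [C C0 HC] := bnd _ ca a0.
have da0 := derive_out a0.
have [L L0 HL] := bnd _ cda da0.
have lip s t : s < t -> `|a t - a s| <= (C + L) * `|t - s|.
  move=> st; have [xi _ ->] := MVT st (fun x _ => derivableP (da x)) (continuous_subspaceT ca).
  by rewrite normrM ler_wpM2r // (le_trans (HL _)) // lerDr.
exists (C + L); split=> [t|s t]; first by rewrite (le_trans (HC t)) // lerDl.
have [st|ts|->] := ltgtP s t; last by rewrite !subrr normr0 mulr0.
  by rewrite distrC [`|s - t|]distrC lip.
exact: lip.
Qed.

End one_variable.

(** * Integrable and square integrable functions on a set of finite measure *)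

Section L12.
Context d (T : measurableType d) (R : realType)
  (mu : {measure set T -> \bar R}) (D : set T).
Hypotheses (mD : measurable D) (muD : (mu D < +oo)%E).
Implicit Types f g h w : T -> R.

Definition L1 f := mu.-integrable D (EFin \o f).
Definition L2 f := measurable_fun D f /\ L1 (fun x => f x ^+ 2).
Definition cvgL1 (f_ : nat -> T -> R) f :=
  (fun n => \int[mu]_(x in D) `|f_ n x - f x|) @ \oo --> (0 : R).
Definition cvgL2 (f_ : nat -> T -> R) f :=
  (fun n => \int[mu]_(x in D) (f_ n x - f x) ^+ 2) @ \oo --> (0 : R).

Lemma L1_measurable f : L1 f -> measurable_fun D f.
Proof. by move=> /integrableP[/measurable_EFinP]. Qed.

Lemma le_L1 f g : measurable_fun D f -> L1 g ->
  (forall x, D x -> `|f x| <= g x) -> L1 f.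
Proof.
move=> mf g1 fg; apply: (le_integrable _ _ _ g1) => //; first exact/measurable_EFinP.
by move=> x Dx; rewrite /= lee_fin (le_trans (fg _ Dx)) // ler_norm.
Qed.

Lemma L1_cst c : L1 (cst c).
Proof.
apply: measurable_bounded_integrable => //; exact: bounded_cst.
Qed.

Lemma L1_bounded f (C : R) : measurable_fun D f -> (forall x, D x -> `|f x| <= C) -> L1 f.
Proof. by move=> mf fC; apply: le_L1 mf (L1_cst C) _. Qed.

Lemma L1D f g : L1 f -> L1 g -> L1 (fun x => f x + g x).
Proof. by move=> f1 g1; exact: (integrableD mD f1 g1). Qed.

Lemma L1B f g : L1 f -> L1 g -> L1 (fun x => f x - g x).
Proof. by move=> f1 g1; exact: (integrableB mD f1 g1). Qed.

Lemma L1Z c f : L1 f -> L1 (fun x => c * f x).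
Proof. by move=> f1; exact: (integrableZl mD c f1). Qed.

Lemma L1_norm f : L1 f -> L1 (fun x => `|f x|).
Proof. by move=> f1; exact: (integrable_norm f1). Qed.

Lemma L1_mulbounded h w (C : R) : measurable_fun D h -> (forall x, D x -> `|h x| <= C) ->
  L1 w -> L1 (fun x => h x * w x).
Proof.
move=> mh hC w1; apply: le_L1 (L1Z C (L1_norm w1)) _.
  by apply: measurable_funM => //; exact: L1_measurable.
by move=> x Dx; rewrite normrM ler_wpM2r // hC.
Qed.

Lemma L2_mul f g : L2 f -> L2 g -> L1 (fun x => f x * g x).
Proof.
move=> [mf f2] [mg g2]; apply: le_L1 (L1D f2 g2) _; first exact: measurable_funM.
move=> x _; rewrite normrM -(real_normK (num_real (f x))) -(real_normK (num_real (g x))).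
have := sqr_ge0 (`|f x| - `|g x|); have := normr_ge0 (f x); have := normr_ge0 (g x).
nra.
Qed.

Lemma L2_bounded f (C : R) : measurable_fun D f -> (forall x, D x -> `|f x| <= C) -> L2 f.
Proof.
move=> mf fC; split=> //; apply: (@L1_bounded _ (C ^+ 2)); first exact: measurable_funX.
by move=> x Dx; rewrite normrX lerXn2r ?nnegrE //; [exact: le_trans (normr_ge0 _) (fC _ Dx)|exact: fC].
Qed.

Lemma L2_cst c : L2 (cst c).
Proof. by apply: (@L2_bounded _ `|c|). Qed.

Lemma L2_L1 f : L2 f -> L1 f.
Proof.
move=> f2; have := L2_mul f2 (L2_cst 1).
by apply: eq_integrable => // x _ /=; rewrite mulr1.
Qed.

Lemma L2D f g : L2 f -> L2 g -> L2 (fun x => f x + g x).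
Proof.
move=> f2 g2; have fg := L2_mul f2 g2; have [mf f2'] := f2; have [mg g2'] := g2.
split; first exact: measurable_funD.
have := L1D (L1D f2' (L1Z 2 fg)) g2'.
by apply: eq_integrable => // x _ /=; congr (_%:E); ring.
Qed.

Lemma L2Z c f : L2 f -> L2 (fun x => c * f x).
Proof.
move=> [mf f2]; split; first exact: measurable_funM.
by have := L1Z (c ^+ 2) f2; apply: eq_integrable => // x _ /=; rewrite exprMn.
Qed.

Lemma L2B f g : L2 f -> L2 g -> L2 (fun x => f x - g x).
Proof.
move=> f2 g2; have := L2D f2 (L2Z (-1) g2).
rewrite (_ : (fun x => f x + -1 * g x) = (fun x => f x - g x)) //.
by apply/funext => x; rewrite mulN1r.
Qed.

Lemma int_norm_ge0 f : 0 <= \int[mu]_(x in D) `|f x|.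
Proof. exact: Rintegral_ge0. Qed.

Lemma le_int_norm f g : L1 f -> L1 g -> (forall x, D x -> `|f x| <= g x) ->
  \int[mu]_(x in D) `|f x| <= \int[mu]_(x in D) g x.
Proof. by move=> f1 g1 fg; apply: le_Rintegral => //; exact: L1_norm. Qed.

(** The integral of [(t * `|f| + `|g|) ^+ 2] is a nonnegative quadratic function
    of [t]. *)
Lemma Cauchy_Schwarz f g : L2 f -> L2 g ->
  (\int[mu]_(x in D) `|f x * g x|) ^+ 2 <=
  \int[mu]_(x in D) f x ^+ 2 * \int[mu]_(x in D) g x ^+ 2.
Proof.
move=> f2 g2; have fg := L1_norm (L2_mul f2 g2).
set P := \int[mu]_(x in D) _; set a := \int[mu]_(x in D) _; set b := \int[mu]_(x in D) _.
have P0 : 0 <= P by exact: int_norm_ge0.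
have quad t : 0 <= a * t ^+ 2 + 2 * t * P + b.
  rewrite mulrC -RintegralZl //; last by case: f2.
  rewrite -RintegralZl // -RintegralD //; last 2 first.
    by apply: L1Z; case: f2.
    by apply: L1Z.
  rewrite -RintegralD //; last 2 first.
    by apply: L1D; [apply: L1Z; case: f2|apply: L1Z].
    by case: g2.
  apply: Rintegral_ge0 => x _.
  rewrite normrM -(real_normK (num_real (f x))) -(real_normK (num_real (g x))).
  rewrite (_ : _ + _ = (t * `|f x| + `|g x|) ^+ 2) ?sqr_ge0 //; ring.
have a0 : 0 <= a by apply: Rintegral_ge0 => x _; exact: sqr_ge0.
have [a00|an0] := eqVneq a 0.
  (* The quadratic function degenerates to an affine one; if its slope were not
     0, its value at this point would be [-1]. *)
  have := quad (- (b + 1) / (2 * P)); rewrite a00.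
  have [->|Pn0] := eqVneq P 0; first by move=> _; rewrite expr0n /= mul0r.
  rewrite mul0r add0r (_ : 2 * _ * P = - (b + 1)); first by move=> ?; exfalso; lra.
  by field; rewrite Pn0.
(* The minimum of the quadratic function. *)
have := quad (- P / a).
rewrite (_ : a * _ + _ + _ = (a * b - P ^+ 2) / a); last by field.
by rewrite pmulr_lge0 ?invr_gt0 ?lt_neqAle 1?eq_sym ?an0 // subr_ge0.
Qed.

Lemma Cauchy_Schwarz_sqrt f g : L2 f -> L2 g ->
  \int[mu]_(x in D) `|f x * g x| <=
  Num.sqrt (\int[mu]_(x in D) f x ^+ 2) * Num.sqrt (\int[mu]_(x in D) g x ^+ 2).
Proof.
move=> f2 g2.
rewrite -sqrtrM; last by apply: Rintegral_ge0 => x _; exact: sqr_ge0.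
rewrite -[leLHS]ger0_norm ?int_norm_ge0 // -sqrtr_sqr.
by rewrite ler_wsqrtr // Cauchy_Schwarz.
Qed.

Lemma cvgL1_int (f_ : nat -> T -> R) f : (forall n, L1 (f_ n)) -> L1 f -> cvgL1 f_ f ->
  (fun n => \int[mu]_(x in D) f_ n x) @ \oo --> \int[mu]_(x in D) f x.
Proof.
move=> f_1 f1 H; apply/cvgrPdist_le => e e0; near=> n.
have := L1B (f_1 n) f1 => fn1.
rewrite /= distrC -(RintegralB mD (f_1 n) f1).
apply: le_trans (le_normr_Rintegral _ _) _ => //.
rewrite -[leLHS]ger0_norm ?int_norm_ge0 //.
by near: n; move/cvgr0Pnorm_le : H; apply.
Unshelve. all: by end_near. Qed.

Lemma cvgL1_squeeze (f_ : nat -> T -> R) f (u : nat -> R) :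
  (forall n, \int[mu]_(x in D) `|f_ n x - f x| <= u n) -> u @ \oo --> (0 : R) ->
  cvgL1 f_ f.
Proof.
move=> fu u0; apply: (@squeeze_cvgr _ _ _ _ (cst 0) u) => //; last exact: cvg_cst.
by apply: nearW => n; rewrite /= int_norm_ge0 fu.
Qed.

Lemma cvg_sqrt0 (u : nat -> R) : u @ \oo --> (0 : R) ->
  (fun n => Num.sqrt (u n)) @ \oo --> (0 : R).
Proof.
move=> u0; rewrite -[X in _ --> X](@sqrtr0 R).
by apply: (cvg_comp u (@Num.sqrt R) u0); exact: sqrt_continuous.
Qed.

Lemma cvgL2_mul (f_ g_ : nat -> T -> R) f g : (forall n, L2 (f_ n)) -> (forall n, L2 (g_ n)) ->
  L2 f -> L2 g -> cvgL2 f_ f -> cvgL2 g_ g ->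
  cvgL1 (fun n x => f_ n x * g_ n x) (fun x => f x * g x).
Proof.
move=> f_2 g_2 f2 g2 cf cg.
pose a := Num.sqrt (\int[mu]_(x in D) f x ^+ 2).
pose b := Num.sqrt (\int[mu]_(x in D) g x ^+ 2).
pose u n := Num.sqrt (\int[mu]_(x in D) (f_ n x - f x) ^+ 2).
pose v n := Num.sqrt (\int[mu]_(x in D) (g_ n x - g x) ^+ 2).
apply: (@cvgL1_squeeze _ _ (fun n => u n * v n + u n * b + a * v n)).
  move=> n; have fn2 := L2B (f_2 n) f2; have gn2 := L2B (g_2 n) g2.
  apply: le_trans (lerD (lerD (Cauchy_Schwarz_sqrt fn2 gn2) (Cauchy_Schwarz_sqrt fn2 g2))
    (Cauchy_Schwarz_sqrt f2 gn2)).
  have i1 := L1_norm (L2_mul fn2 gn2); have i2 := L1_norm (L2_mul fn2 g2).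
  have i3 := L1_norm (L2_mul f2 gn2).
  rewrite -RintegralD // -RintegralD //; last exact: L1D.
  apply: le_int_norm; [|exact: L1D (L1D i1 i2) i3|].
    by apply: L1B; apply: L2_mul.
  move=> x _; rewrite (_ : _ - _ = (f_ n x - f x) * (g_ n x - g x) +
     (f_ n x - f x) * g x + f x * (g_ n x - g x)); last by ring.
  by apply: le_trans (ler_normD _ _) _; rewrite lerD2r ler_normD.
have u0 : u @ \oo --> (0 : R) by exact: cvg_sqrt0.
have v0 : v @ \oo --> (0 : R) by exact: cvg_sqrt0.
have -> : 0 = 0 * 0 + 0 * b + a * 0 :> R by rewrite mulr0 mul0r mulr0 !addr0.
apply: cvgD; first apply: cvgD.
- exact: cvgM.
- by apply: cvgM => //; exact: cvg_cst.
- by apply: cvgM => //; exact: cvg_cst.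
Qed.

Lemma cvgL2_L1 (f_ : nat -> T -> R) f : (forall n, L2 (f_ n)) -> L2 f -> cvgL2 f_ f -> cvgL1 f_ f.
Proof.
move=> f_2 f2 cf.
have c1 : cvgL2 (fun=> cst 1) (cst (1 : R)).
  rewrite /cvgL2 (_ : (fun n => _) = cst 0); first exact: cvg_cst.
  apply/funext => n /=; rewrite subrr expr0n /=.
  by rewrite Rintegral_cst // mul0r.
have := cvgL2_mul f_2 (fun=> L2_cst 1) f2 (L2_cst 1) cf c1.
rewrite (_ : (fun n x => f_ n x * cst 1 x) = f_); last first.
  by apply/funext => n; apply/funext => x /=; rewrite mulr1.
by rewrite (_ : (fun x => f x * cst 1 x) = f) //; apply/funext => x /=; rewrite mulr1.
Qed.

Lemma dominated_Rintegral (f_ : nat -> T -> R) f g :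
  (forall n, measurable_fun D (f_ n)) -> measurable_fun D f -> L1 g ->
  (forall x, D x -> (fun n => f_ n x) @ \oo --> f x) ->
  (forall n x, D x -> `|f_ n x| <= g x) ->
  (fun n => \int[mu]_(x in D) f_ n x) @ \oo --> \int[mu]_(x in D) f x.
Proof.
move=> mf_ mf g1 cf fg.
have f1 : L1 f.
  apply: (le_L1 mf g1) => x Dx.
  apply: (@closed_cvg _ _ _ eventually_filter (fun n => `|f_ n x|) [set y | y <= g x]).
  - exact: closed_le.
  - by apply: nearW => n; exact: fg.
  - by apply: cvg_norm; exact: cf.
have mEf_ n : measurable_fun D (EFin \o f_ n) by exact/measurable_EFinP.
have mEf : measurable_fun D (EFin \o f) by exact/measurable_EFinP.
have [] := @dominated_convergence _ _ _ mu D mD (fun n => EFin \o f_ n) (EFin \o f)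
  (EFin \o g) mEf_ mEf.
- apply: aeW => x Dx; apply: cvg_EFin; first exact: nearW.
  exact: cf.
- exact: g1.
- by apply: aeW => x n Dx; rewrite lee_fin fg.
move=> _ _ H; apply: fine_cvg.
by rewrite /Rintegral fineK //; exact: integrable_fin_num.
Qed.

(** A factor tending to 0 in mean, but bounded, may be multiplied by a fixed
    integrable function: the latter is approximated by its truncations. *)
Lemma cvgL1_bounded_mul (h_ : nat -> T -> R) w (C : R) :
  (forall n, measurable_fun D (h_ n)) -> (forall n x, D x -> `|h_ n x| <= C) ->
  L1 w -> cvgL1 h_ (cst 0) -> cvgL1 (fun n x => h_ n x * w x) (cst 0).
Proof.
move=> mh hC w1 h0; have mw := L1_measurable w1.
pose tr (m : nat) x := if `|w x| <= m%:R then w x else 0.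
have mtr m : measurable_fun D (tr m).
  apply: measurable_fun_if => //.
    by apply: measurable_fun_ler => //; exact: measurableT_comp.
  apply: measurable_funS mw => //; exact: subIsetl.
have tr1 m : L1 (tr m).
  apply: le_L1 (mtr m) (L1_norm w1) _ => x _.
  by rewrite /tr; case: ifP => // _; rewrite normr0.
have trw : cvgL1 tr w.
  have := @dominated_Rintegral (fun m x => `|tr m x - w x|) (cst 0) (fun x => `|w x|).
  rewrite Rintegral_cst // mul0r; apply.
  - by move=> m; apply: measurableT_comp => //; exact: measurable_funB.
  - exact: measurable_cst.
  - exact: L1_norm.
  - move=> x Dx; apply: cvg_near_cst.
    near=> m; rewrite /tr ifT ?subrr ?normr0 //; near: m.
    by exact: nbhs_infty_ger.
  - move=> m x Dx; rewrite normr_id /tr; case: ifP => _; first by rewrite subrr normr0.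
    by rewrite sub0r normrN.
apply/cvgr0Pnorm_le => e e0.
have Cn0 : 0 < 2 * (`|C| + 1) by rewrite mulr_gt0 // ltr_wpDl.
have [M _ /(_ M (leqnn _)) HM] := (cvgr0Pnorm_le _).1 trw _ (divr_gt0 e0 Cn0).
have M0 : 0 < 2 * (M%:R + 1) :> R by rewrite mulr_gt0 // ltr_wpDl.
near=> n.
have hn1 : L1 (h_ n) by exact: (L1_bounded (mh n) (hC n)).
rewrite ger0_norm ?int_norm_ge0 //.
pose a := \int[mu]_(x in D) `|tr M x - w x|.
pose b := \int[mu]_(x in D) `|h_ n x - cst 0 x|.
have b1 : L1 (fun x => `|h_ n x - cst 0 x|) by apply: L1_norm; apply: L1B => //; exact: L1_cst.
have a1 : L1 (fun x => `|tr M x - w x|) by apply: L1_norm; exact: L1B.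
apply: (@le_trans _ _ ((`|C| + 1) * a + (M%:R + 1) * b)).
  rewrite -!RintegralZl // -RintegralD //; [|exact: L1Z..].
  apply: le_int_norm; [|by apply: L1D; exact: L1Z|].
    by apply: L1B (L1_cst _); exact: (L1_mulbounded (mh n) (hC n)).
  move=> x Dx; rewrite /= !subr0.
  rewrite (_ : h_ n x * w x = - (h_ n x * (tr M x - w x)) + h_ n x * tr M x); last by ring.
  apply: le_trans (ler_normD _ _) _; rewrite normrN !normrM; apply: lerD.
    rewrite ler_wpM2r // (le_trans (hC _ _ Dx)) // (le_trans (ler_norm _)) // lerDl //.
  rewrite mulrC ler_wpM2r // /tr; case: ifP => [H|_]; first by rewrite (le_trans H) // lerDl.
  by rewrite normr0 addr_ge0.
rewrite [leRHS](splitr e) lerD //.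
  rewrite -ler_pdivlMl ?ltr_wpDl // (le_trans (ler_norm _)) // (le_trans HM) //.
  by rewrite invfM mulrA mulrC.
rewrite -ler_pdivlMl ?ltr_wpDl // (le_trans (ler_norm _)) //.
rewrite mulrC -mulrA -invfM.
rewrite /b; near: n; apply: (cvgr0Pnorm_le _).1 => //.
by rewrite divr_gt0.
Unshelve. all: by end_near. Qed.

(** In the difference of the two products the bounded factor [h_ n] meets
    [w_ n - w], which is small in mean, and [h_ n - h] meets the fixed function
    [w], which is the case of [cvgL1_bounded_mul]. *)
Lemma cvg_int_mul (h_ w_ : nat -> T -> R) h w (C : R) :
  (forall n, measurable_fun D (h_ n)) -> measurable_fun D h ->
  (forall n x, D x -> `|h_ n x| <= C) -> (forall x, D x -> `|h x| <= C) ->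
  (forall n, L1 (w_ n)) -> L1 w -> cvgL1 h_ h -> cvgL1 w_ w ->
  (fun n => \int[mu]_(x in D) (h_ n x * w_ n x)) @ \oo -->
    \int[mu]_(x in D) (h x * w x).
Proof.
move=> mh_ mh h_C hC w_1 w1 ch cw.
apply: cvgL1_int.
- by move=> n; exact: (L1_mulbounded (mh_ n) (h_C n)).
- exact: (L1_mulbounded mh hC).
pose g_ n x := h_ n x - h x.
have mg n : measurable_fun D (g_ n) by exact: measurable_funB.
have gC n x : D x -> `|g_ n x| <= C + C.
  by move=> Dx; rewrite (le_trans (ler_normB _ _)) // lerD // ?h_C // hC.
have cg : cvgL1 g_ (cst 0).
  by apply: cvg_trans ch; apply: near_eq_cvg; apply: nearW => n;
     apply: eq_Rintegral => x _; rewrite subr0.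
have gw := cvgL1_bounded_mul mg gC w1 cg.
apply: (@cvgL1_squeeze _ _ (fun n => C * \int[mu]_(x in D) `|w_ n x - w x| +
   \int[mu]_(x in D) `|g_ n x * w x - cst 0 x|)).
  move=> n; have ww : L1 (fun x => `|w_ n x - w x|) by apply: L1_norm; exact: L1B.
  have gw1 : L1 (fun x => g_ n x * w x) by exact: (L1_mulbounded (mg n) (gC n)).
  have gw0 : L1 (fun x => `|g_ n x * w x - cst 0 x|).
    by apply: L1_norm; apply: L1B => //; exact: L1_cst.
  rewrite -RintegralZl // -RintegralD //; last exact: L1Z.
  apply: le_int_norm; [|by apply: L1D => //; exact: L1Z|].
    by apply: L1B; [exact: (L1_mulbounded (mh_ n) (h_C n))|exact: (L1_mulbounded mh hC)].
  move=> x Dx.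
  rewrite (_ : _ - _ = h_ n x * (w_ n x - w x) + g_ n x * w x); last by rewrite /g_; ring.
  rewrite subr0 (le_trans (ler_normD _ _)) // lerD2r normrM ler_wpM2r //.
  exact: h_C.
rewrite -[X in _ --> X](addr0 0) -[X in X + _](mulr0 C).
by apply: cvgD => //; apply: cvgM => //; exact: cvg_cst.
Qed.

End L12.

(** * Open sets of the plane *)

Section rectangles.
Context (R : realType).
Implicit Types (U : set (R * R)) (q : (R * R) * (R * R)).

Definition orect q : set (R * R) := `]q.1.1, q.1.2[%classic `*` `]q.2.1, q.2.2[%classic.
Definition crect q : set (R * R) := `[q.1.1, q.1.2]%classic `*` `[q.2.1, q.2.2]%classic.

(** The closed rectangles too lie in [U]: a product of plateaus over one of the
    open rectangles is then supported by a compact subset of [U]. *)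
Lemma open_orect_cover U : open U ->
  exists q : nat -> (R * R) * (R * R),
    (forall n, crect (q n) `<=` U) /\ U = \bigcup_n orect (q n).
Proof.
move=> oU.
pose rr (r : (rat * rat) * (rat * rat)) : (R * R) * (R * R) :=
  ((ratr r.1.1, ratr r.1.2), (ratr r.2.1, ratr r.2.2)).
(* Indices that code no admissible rational rectangle get an empty one. *)
pose q n := if unpickle n is Some r then
  if `[< crect (rr r) `<=` U >] then rr r else ((1, 0), (1, 0)) else ((1, 0), (1, 0)).
have e0 : crect ((1, 0), (1, 0)) = set0.
  apply/seteqP; split=> // x []; rewrite /= !in_itv /= => /andP[a b] _.
  by exfalso; lra.
exists q; split.
  by rewrite /q => n; case: unpickle => [r|]; [case: asboolP => // _|]; rewrite e0; exact: sub0set.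
apply/seteqP; split=> [x Ux|x [n _]]; last first.
  have oc q' : orect q' `<=` crect q'.
    by move=> y [y1 y2]; split; [move: y1|move: y2]; rewrite /= !in_itv /= => /andP[/ltW -> /ltW ->].
  rewrite /q; case: unpickle => [r|/oc]; last by rewrite e0.
  by case: asboolP => [rU /oc /rU //|_ /oc]; rewrite e0.
have [e /= e_gt0 eU] := (nbhs_ballP x U).1 (oU x Ux).
have h (t : R) : exists p : rat * rat, [/\ t - e < ratr p.1, ratr p.1 < t, t < ratr p.2 & ratr p.2 < t + e].
  have [p1] := @rat_in_itvoo R (t - e) t ltac:(by rewrite ltrBlDr ltrDl).
  have [p2] := @rat_in_itvoo R t (t + e) ltac:(by rewrite ltrDl).
  rewrite !in_itv /= => /andP[a b] /andP[c d].
  by exists (p1, p2).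
have [p1 [a1 b1 c1 d1]] := h x.1; have [p2 [a2 b2 c2 d2]] := h x.2.
exists (pickle (p1, p2)) => //; rewrite /q pickleK.
case: asboolP => [_|[]]; first by split; rewrite /= in_itv /= ?b1 ?c1 ?b2 ?c2.
move=> y [y1 y2]; apply: eU; split; rewrite /ball /= ltr_norml.
  move: y1; rewrite /= in_itv /= => /andP[u v].
  by apply/andP; split; lra.
move: y2; rewrite /= in_itv /= => /andP[u v].
by apply/andP; split; lra.
Qed.

Lemma measurable_orect q : measurable (orect q : set (measurableTypeR R * measurableTypeR R)).
Proof. by apply: measurableX; exact: measurable_itv. Qed.

Lemma open_measurable2 U : open U ->
  measurable (U : set (measurableTypeR R * measurableTypeR R)).
Proof.
move=> /open_orect_cover[q [_ ->]].
by apply: bigcupT_measurable => n; exact: measurable_orect.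
Qed.

Lemma continuous_measurable2 (f : R * R -> R) : continuous f ->
  measurable_fun [set: measurableTypeR R * measurableTypeR R] f.
Proof.
move=> /continuousP cf; apply: (measurability _ (RGenOpens.measurableE R)).
move=> _ [_ [a [b ->] <-]]; rewrite setTI.
by apply: open_measurable2; apply: cf; exact: interval_open.
Qed.

End rectangles.

Notation plane R := (measurableTypeR R * measurableTypeR R)%type.

Section generated.
Context (R : realType).

(** Rectangles form a generating family stable under intersection, as a Dynkin
    argument requires. *)
Lemma measurable_orectE :
  @measurable _ (plane R) = <<s range (@orect R) >>.
Proof.
apply/seteqP; split; last first.
  apply: smallest_sub; first exact: sigma_algebra_measurable.
  by move=> _ [q _ <-]; exact: measurable_orect.
have cov (f : R * R -> R) (r : R -> R -> nat -> (R * R) * (R * R)) :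
    (forall a b, f @^-1` `]a, b[ = \bigcup_n orect (r a b n)) ->
    preimage_set_system setT f (@measurable _ (measurableTypeR R)) `<=` <<s range (@orect R) >>.
  move=> fE _ [A mA <-].
  have : @measurable_fun _ _ (g_sigma_algebraType (range (@orect R))) (measurableTypeR R) setT f.
    apply: (measurability _ (RGenOpens.measurableE R)).
    move=> _ [_ [a [b ->] <-]]; rewrite setTI fE.
    by apply: bigcupT_measurable => n; apply: sub_sigma_algebra; exists (r a b n).
  by move=> /(_ measurableT _ mA).
have big (t : R) : exists n : nat, t \in `]- n%:R, n%:R[.
  exists (Num.bound `|t|); rewrite in_itv /= -ltr_norml.
  exact: archi_boundP.
apply: smallest_sub; first exact: smallest_sigma_algebra.
rewrite subUset; split.
- apply: (@cov fst (fun a b n => ((a, b), (- n%:R, n%:R)))) => a b.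
  apply/seteqP; split=> [x xab|x [n _] []//].
  by have [n xn] := big x.2; exists n.
- apply: (@cov snd (fun a b n => ((- n%:R, n%:R), (a, b)))) => a b.
  apply/seteqP; split=> [x xab|x [n _] []//].
  by have [n xn] := big x.1; exists n.
Qed.

Lemma orectI (q q' : (R * R) * (R * R)) : orect q `&` orect q' =
  orect ((Num.max q.1.1 q'.1.1, Num.min q.1.2 q'.1.2),
         (Num.max q.2.1 q'.2.1, Num.min q.2.2 q'.2.2)).
Proof.
apply/seteqP; split=> [x [[/= + +] [/= + +]]|x [/= + +]];
  rewrite !in_itv /= ?gt_max ?lt_min.
  by move=> /andP[a b] /andP[c d] /andP[a' b'] /andP[c' d']; split;
     rewrite /= in_itv /= gt_max lt_min ?a ?b ?a' ?b' ?c ?d ?c' ?d'.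
by move=> /andP[/andP[a a'] /andP[b b']] /andP[/andP[c c'] /andP[d d']];
  split; split; rewrite /= in_itv /= ?a ?b ?a' ?b' ?c ?d ?c' ?d'.
Qed.

Lemma measurable_fun_plane d (T : measurableType d) (D : set T) (F : T -> R * R) :
  measurable_fun D (fst \o F) -> measurable_fun D (snd \o F) ->
  measurable_fun D (F : T -> plane R).
Proof.
move=> m1 m2 mD; apply: (measurability _ measurable_orectE) => //.
move=> _ [_ [q _ <-] <-].
rewrite (_ : _ `&` _ = (D `&` (fst \o F) @^-1` `]q.1.1, q.1.2[%classic) `&`
   (D `&` (snd \o F) @^-1` `]q.2.1, q.2.2[%classic)).
  by apply: measurableI; [apply: m1 => //; exact: measurable_itv|
                          apply: m2 => //; exact: measurable_itv].
by apply/seteqP; split=> [x [Dx []]//|x [[Dx ?] [_ ?]]].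
Qed.

End generated.

(** * Transfer of integrals along a map *)

Import HBNNSimple.

Section transfer.
Context d (T : measurableType d) (R : realType)
  (mu : {measure set T -> \bar R}) (D : set T)
  (Omega : set (R * R)) (F : T -> R * R) (w : T -> R) (v : R * R -> R).
Hypotheses (mD : measurable D) (oO : open Omega)
  (mF : measurable_fun D (F : T -> plane R)) (FO : forall x, D x -> Omega (F x))
  (w1 : L1 mu D w) (v1 : L1 (leb2 R) Omega v).
Implicit Types (h : R * R -> R).

Let mO : measurable (Omega : set (plane R)).
Proof. exact: open_measurable2. Qed.

(** The image under [F] of the signed measure with density [w] has the density
    [v], as far as [h] can tell. *)
Definition same_integral h :=
  \int[mu]_(x in D) (h (F x) * w x) = \int[leb2 R]_(y in Omega) (h y * v y).

Let good h := measurable_fun [set: plane R] h /\ exists C : R, forall y, `|h y| <= C.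

Let good_indic (A : set (plane R)) : measurable A -> good \1_A.
Proof.
move=> mA; split; first exact: measurable_indic.
by exists 1 => y; rewrite indicE; case: (_ \in _); rewrite /= ?normr1 ?normr0.
Qed.

Let goodF h : good h -> L1 mu D (fun x => h (F x) * w x).
Proof.
move=> [mh [C hC]]; apply: (L1_mulbounded mD (C := C)) => //.
exact: (measurableT_comp mh mF).
Qed.

Let goodv h : good h -> L1 (leb2 R) Omega (fun y => h y * v y).
Proof.
move=> [mh [C hC]]; apply: (L1_mulbounded mO (C := C)) => //.
exact: measurable_funTS.
Qed.

Let same_lin h k (a b : R) : good h -> good k -> same_integral h -> same_integral k ->
  same_integral (fun y => a * h y + b * k y).
Proof.
move=> gh gk eh ek; rewrite /same_integral.
rewrite (_ : \int[mu]_(x in D) _ =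
  \int[mu]_(x in D) (a * (h (F x) * w x) + b * (k (F x) * w x))); last first.
  by apply: eq_Rintegral => x _; ring.
rewrite [RHS](_ : _ = \int[leb2 R]_(y in Omega) (a * (h y * v y) + b * (k y * v y))); last first.
  by apply: eq_Rintegral => x _; ring.
have h1 := goodF gh; have h2 := goodF gk; have h3 := goodv gh; have h4 := goodv gk.
rewrite !RintegralD //; try exact: L1Z.
by rewrite !RintegralZl // eh ek.
Qed.

Let good_lin h k (a b : R) : good h -> good k -> good (fun y => a * h y + b * k y).
Proof.
move=> [mh [C hC]] [mk [C' kC]]; split.
  by apply: measurable_funD; apply: measurable_funM => //; exact: measurable_cst.
exists (`|a| * C + `|b| * C') => y; apply: le_trans (ler_normD _ _) _.
by rewrite !normrM lerD // ler_wpM2l.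
Qed.

Let same_lim (h_ : nat -> R * R -> R) h (C : R) :
  (forall n, measurable_fun [set: plane R] (h_ n)) -> measurable_fun [set: plane R] h ->
  (forall n y, `|h_ n y| <= C) -> (forall y, (fun n => h_ n y) @ \oo --> h y) ->
  (forall n, same_integral (h_ n)) -> same_integral h.
Proof.
move=> mh_ mh h_C ch eh.
have c1 : (fun n => \int[mu]_(x in D) (h_ n (F x) * w x)) @ \oo -->
    \int[mu]_(x in D) (h (F x) * w x).
  have mw : measurable_fun D w by exact: L1_measurable w1.
  apply: (@dominated_Rintegral _ _ _ mu D mD _ _ (fun x => C * `|w x|)) => //.
  - by move=> n; apply: measurable_funM => //; exact: (measurableT_comp (mh_ n) mF).
  - by apply: measurable_funM => //; exact: (measurableT_comp mh mF).
  - by apply: L1Z => //; exact: L1_norm.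
  - by move=> x _; apply: cvgM; [exact: ch|exact: cvg_cst].
  - by move=> n x _; rewrite normrM ler_wpM2r.
have c2 : (fun n => \int[leb2 R]_(y in Omega) (h_ n y * v y)) @ \oo -->
    \int[leb2 R]_(y in Omega) (h y * v y).
  have mv : measurable_fun (Omega : set (plane R)) v by exact: L1_measurable v1.
  apply: (@dominated_Rintegral _ _ _ (leb2 R) _ mO _ _ (fun x => C * `|v x|)) => //.
  - by move=> n; apply: measurable_funM => //; exact: measurable_funTS.
  - by apply: measurable_funM => //; exact: measurable_funTS.
  - by apply: L1Z => //; exact: L1_norm.
  - by move=> x _; apply: cvgM; [exact: ch|exact: cvg_cst].
  - by move=> n x _; rewrite normrM ler_wpM2r.
have E : (fun n => \int[mu]_(x in D) (h_ n (F x) * w x)) =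
  (fun n => \int[leb2 R]_(y in Omega) (h_ n y * v y)) by apply/funext => n; exact: eh.
by rewrite E in c1; exact: (cvg_unique _ c1 c2).
Qed.

Let same_eq h k : (forall y, Omega y -> h y = k y) -> same_integral h -> same_integral k.
Proof.
move=> hk; rewrite /same_integral => E.
rewrite (_ : \int[mu]_(x in D) _ = \int[mu]_(x in D) (h (F x) * w x)); last first.
  by apply: eq_Rintegral => x; rewrite inE => Dx; rewrite hk //; exact: FO.
by rewrite E; apply: eq_Rintegral => y; rewrite inE => Oy; rewrite hk.
Qed.

(** The increments are asked for, rather than the sets themselves, because a
    union of disjoint sets and a union of rectangles are both filled up by
    increments on which the equality is known. *)
Let same_union (A : nat -> set (plane R)) : (forall n, measurable (A n)) ->
  same_integral \1_(A 0%N) ->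
  (forall n, same_integral \1_(A n.+1 `\` A n)) -> (forall n, A n `<=` A n.+1) ->
  same_integral \1_(\bigcup_n A n).
Proof.
move=> mA A0 AS nd.
have sA n : same_integral \1_(A n).
  elim: n => // n IH.
  have := same_lin 1 1 (good_indic (mA n)) (good_indic (measurableD (mA n.+1) (mA n))) IH (AS n).
  apply: same_eq => y _; rewrite !mul1r !indicE in_setD -natrD; congr (_%:R).
  have [yn|yn] := boolP (y \in A n) => /=; last by rewrite andbT add0n.
  by rewrite andbF addn0 mem_set //; apply: nd; exact: set_mem.
have ndA : {homo A : n m / (n <= m)%N >-> n `<=` m}.
  by apply: (homo_leq (@subset_refl _)) => // ? ? ?; exact: subset_trans.
apply: (@same_lim (fun n => \1_(A n)) _ 1) => //.
- by apply: measurable_indic; exact: bigcupT_measurable.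
- by move=> n y; rewrite indicE; case: (_ \in _); rewrite /= ?normr1 ?normr0.
- move=> y; apply: cvg_near_cst; rewrite !indicE.
  have [[n _ yn]|yn] := pselect ((\bigcup_n A n) y).
    near=> m; rewrite indicE [y \in \bigcup_n A n]mem_set; last by exists n.
    rewrite mem_set //; apply: ndA yn; near: m.
    exact: nbhs_infty_ge.
  apply: nearW => m; rewrite indicE [y \in \bigcup_n A n]memNset // memNset // => ym.
  by apply: yn; exists m.
Unshelve. all: by end_near. Qed.

Hypothesis same_plateau : forall n a b a' b', crect ((a, b), (a', b')) `<=` Omega ->
  same_integral (fun y => plateau n a b y.1 * plateau n a' b' y.2).

Let same_orect q : crect q `<=` Omega -> same_integral \1_(orect q).
Proof.
case: q => -[a b] [a' b'] qO.
apply: (same_lim (h_ := fun n y => plateau n a b y.1 * plateau n a' b' y.2) (C := 1)).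
- move=> n; apply: measurable_funM.
    apply: measurableT_comp => //; apply: continuous_measurable_fun.
    exact: (Cdir_continuous (Cdir_plateau 0 n a b)).
  apply: measurableT_comp => //; apply: continuous_measurable_fun.
  exact: (Cdir_continuous (Cdir_plateau 0 n a' b')).
- by apply: measurable_indic; exact: measurable_orect.
- move=> n y; have /andP[p0 p1] := plateau_ge0_le1 n a b y.1.
  have /andP[r0 r1] := plateau_ge0_le1 n a' b' y.2.
  by rewrite normrM !ger0_norm // mulr_ile1.
- move=> y; rewrite (_ : \1__ y = \1_(`]a, b[%classic) y.1 * \1_(`]a', b'[%classic) y.2 :> R).
    by apply: cvgM; exact: plateau_cvg.
  rewrite !indicE -natrM mulnb; congr (nat_of_bool _)%:R.
  by apply/idP/andP; rewrite !inE.
- by move=> n; exact: same_plateau.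
Qed.

(** Fixing one rectangle makes the class of admissible [B] a Dynkin system: it
    has to contain the whole plane, and only rectangles with closure in [Omega]
    are available. *)
Let same_measurable_orect q (B : set (plane R)) : crect q `<=` Omega -> measurable B ->
  same_integral \1_(B `&` orect q).
Proof.
move=> qO; have mq := measurable_orect q.
rewrite measurable_orectE.
pose P (A : set (plane R)) : Prop := same_integral \1_(A `&` orect q).
move=> sB; rewrite -/(P B); move: B sB.
apply: (@dynkin_induction _ _ _ P (measurable_orectE R)); rewrite /P.
- by move=> _ _ [q1 _ <-] [q2 _ <-]; rewrite orectI; eexists.
- by rewrite setTI; exact: same_orect.
- move=> _ [q' _ <-]; rewrite orectI; apply: same_orect.
  apply: subset_trans qO => x [/= + +].
  rewrite !in_itv /= !ge_max !le_min.
  move=> /andP[/andP[_ a] /andP[_ b]] /andP[/andP[_ c] /andP[_ e]].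
  by split; rewrite /= in_itv /= ?a ?b ?c ?e.
- move=> S mS IH.
  have := same_lin 1 (- 1) (good_indic mq) (good_indic (measurableI _ _ mS mq))
    (same_orect qO) IH.
  apply: same_eq => y _; rewrite mul1r !indicE.
  move: (orect q) => Q; rewrite !in_setI in_setC.
  by case: (y \in S); case: (y \in Q); rewrite /= ?mulr0 ?mulr1 ?addr0 ?addrN ?subrr.
- move=> S mS tS IH.
  pose A n := \bigcup_(k < n) (S k `&` orect q).
  have -> : (\bigcup_k S k) `&` orect q = \bigcup_n A n.
    apply/seteqP; split=> [y [[k _ Sky] yq]|y [n _ [k kn [Sky yq]]]].
      by exists k.+1 => //; exists k => //=.
    by split=> //; exists k.
  apply: same_union.
  + move=> n; apply: bigcup_measurable => k _; exact: measurableI.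
  + rewrite (_ : A 0%N = set0).
      rewrite indic0; have := same_lin 0 0 (good_indic mq) (good_indic mq)
        (same_orect qO) (same_orect qO).
      by apply: same_eq => y _; rewrite !mul0r addr0.
    by apply/seteqP; split=> // y [].
  + move=> n; rewrite (_ : _ `\` _ = S n `&` orect q); first exact: IH.
    apply/seteqP; split=> [y [[k /= kn [Sky yq]] nA]|y [Sny yq]].
      split=> //; move: kn; rewrite ltnS leq_eqVlt => /orP[/eqP <- //|kn].
      by exfalso; apply: nA; exists k.
    split; first by exists n => /=.
    move=> [k /= kn [Sky _]].
    have /trivIsetP /(_ k n I I) := tS.
    rewrite (ltn_eqF kn) => /(_ isT) /seteqP[+ _] => /(_ y); exact.
  + by move=> n y [k /= kn Aky]; exists k => //=; exact: ltnW.
Qed.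

Let same_measurable (B : set (plane R)) : measurable B -> same_integral \1_B.
Proof.
move=> mB; have [q [qO OE]] := open_orect_cover oO.
pose A n := \bigcup_(k < n) (B `&` orect (q k)).
have mA n : measurable (A n : set (plane R)).
  by apply: bigcup_measurable => k _; apply: measurableI => //; exact: measurable_orect.
apply: (@same_eq (\1_(\bigcup_n A n))).
  move=> y; rewrite OE => -[n _ yq]; rewrite !indicE; congr (nat_of_bool _)%:R.
  apply/idP/idP; rewrite !inE; first by move=> [m _ [k _ []]].
  by move=> By; exists n.+1 => //; exists n => /=.
apply: same_union => //.
- rewrite (_ : A 0%N = set0) ?set0D; last by apply/seteqP; split=> // y [].
  rewrite -(set0I (orect (q 0%N))); exact: same_measurable_orect.
- move=> n; rewrite (_ : _ `\` _ = (B `\` A n) `&` orect (q n)).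
    by apply: same_measurable_orect => //; exact: measurableD.
  apply/seteqP; split=> [y [[k /= kn [By yq]] nA]|y [[By nA] yq]].
    split=> //; move: kn; rewrite ltnS leq_eqVlt => /orP[/eqP <- //|kn].
    by exfalso; apply: nA; exists k.
  by split=> //; exists n => /=.
- by move=> n y [k /= kn Aky]; exists k => //=; exact: ltnW.
Qed.

Let same_nnsfun (f : {nnsfun plane R >-> R}) : same_integral f.
Proof.
pose s := finmap.enum_fset (fset_set (range f)).
have mp r : measurable (f @^-1` [set r] : set (plane R)) by exact: measurable_sfunP.
pose g n y := \sum_(i < n) s`_i * \1_(f @^-1` [set s`_i]) y : R.
have gg n : good (g n) /\ same_integral (g n).
  elim: n => [|n [IH1 IH2]].
    have -> : g 0%N = \1_set0 by apply/funext => y; rewrite /g big_ord0 indic0.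
    by split; [exact: good_indic|exact: same_measurable].
  have -> : g n.+1 = (fun y => 1 * g n y + s`_n * \1_(f @^-1` [set s`_n]) y).
    by apply/funext => y; rewrite /g big_ord_recr mul1r.
  by split; [apply: good_lin|apply: same_lin] => //;
    [exact: good_indic|exact: good_indic|exact: same_measurable].
have [_ h] := gg (size s); apply: same_eq h => y _.
by rewrite [RHS]fimfunEord.
Qed.

(** Equality of the integrals of all products of plateaus supported in [Omega]
    extends to bounded measurable functions: rectangles generate the Borel
    sets, and plateaus converge boundedly to indicators of rectangles. *)
Lemma same_bounded h (C : R) : measurable_fun (Omega : set (plane R)) h ->
  (forall y, Omega y -> `|h y| <= C) -> same_integral h.
Proof.
(* Adding [C] makes the function nonnegative, as approximation by an increasing
   sequence of simple functions requires. *)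
move=> mh hC; pose h' := (fun y => h y + C) \_ Omega.
have h'O y : Omega y -> h' y = h y + C by move=> Oy; rewrite /h' patchE mem_set.
have h'0 y : 0 <= h' y.
  rewrite /h' patchE; case: ifPn => // /set_mem /hC.
  by rewrite ler_norml => /andP[+ _]; rewrite -[X in _ -> 0 <= X]addrC; lra.
have h'C y : h' y <= `|C| + `|C|.
  rewrite /h' patchE; case: ifPn => [/set_mem /hC yC|_]; last by rewrite addr_ge0.
  by apply: lerD; rewrite ?ler_norm // (le_trans (ler_norm _)) // (le_trans yC) // ler_norm.
have mh' : measurable_fun [set: plane R] h'.
  apply/(measurable_restrict _ mO measurableT); rewrite setTI.
  by apply: measurable_funD => //; exact: measurable_cst.
have mEh' : measurable_fun [set: plane R] (EFin \o h') by exact/measurable_EFinP.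
have Eh'0 y : [set: plane R] y -> (0%R <= (EFin \o h') y)%E by rewrite lee_fin.
have s' : same_integral h'.
  pose f_ := nnsfun_approx measurableT mEh'.
  apply: (@same_lim (fun n => f_ n) _ (`|C| + `|C|)) => //.
  - move=> n y; rewrite ger0_norm // (le_trans _ (h'C y)) //.
    by rewrite -lee_fin /f_ nnsfun_approxE le_approx.
  - move=> y; have := cvg_nnsfun_approx measurableT mEh' Eh'0 (I : setT y).
    by move=> /fine_cvg.
have sT : same_integral \1_setT by exact: same_measurable.
have gT : good \1_setT by exact: good_indic.
have gh' : good h' by split=> //; exists (`|C| + `|C|) => y; rewrite ger0_norm.
have := same_lin 1 (- C) gh' gT s' sT.
by apply: same_eq => y Oy; rewrite h'O // indicT mul1r /= mulr1 addrK.
Qed.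

End transfer.

(** * Integration by parts in the plane *)

Section by_parts.
Context (R : realType).
Implicit Types (f g eta : R * R -> R) (K Omega : set (R * R)).

Notation C1 := (Cdir (basis2 R) 1).

Lemma C1_derivable k f i x : Cdir (basis2 R) k.+1 f -> derivable f x (basis2 R i).
Proof. by move=> [_ /(_ i)[]]. Qed.

Lemma C1_pderiv k f i : Cdir (basis2 R) k.+1 f -> Cdir (basis2 R) k (pderiv i f).
Proof. by move=> [_ /(_ i)[]]. Qed.

Lemma is_derive_along_line f (v x : R * R) (t : R) : derivable f (t *: v + x) v ->
  is_derive t (1 : R) (fun s : R => f (s *: v + x)) ('D_v f (t *: v + x)).
Proof.
have E : (fun h : R => h^-1 *: (f ((h *: (1 : R) + t) *: v + x) - f (t *: v + x))) =
         (fun h : R => h^-1 *: (f (h *: v + (t *: v + x)) - f (t *: v + x))).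
  by apply/funext => h; rewrite scalerDl addrA [_ *: 1]mulr1.
move=> df; apply: DeriveDef; first by rewrite /derivable E.
by rewrite /derive E.
Qed.

Lemma pderiv_out eta K i : closed K -> (forall x, ~ K x -> eta x = 0) ->
  forall x, ~ K x -> pderiv i eta x = 0.
Proof.
move=> cK e0 x nKx; rewrite /pderiv.
rewrite (@near_eq_derive _ _ _ eta (cst 0)) ?derive_cst //.
have oK : open (~` K) by exact: closed_openC.
by apply: (filterS _ (oK x nKx)) => y /e0 ->.
Qed.

Lemma compact_closed2 K : compact K -> closed K.
Proof. by move=> cK; apply: compact_closed => //; exact: norm_hausdorff. Qed.

Lemma compact_subset_box K : compact K -> exists2 r : R, 0 < r &
  forall x, K x -> `|x.1| < r /\ `|x.2| < r.
Proof.
move=> /compact_bounded[M [_ HM]]; exists (`|M| + 1 + 1); first by rewrite ltr_wpDl // ltr_wpDl.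
move=> x Kx.
have : `|x| <= `|M| + 1 by apply: HM => //; rewrite (le_lt_trans (ler_norm _)) // ltrDl.
rewrite [`|x|]/Num.norm /= ge_max => /andP[a b].
by split; [apply: le_lt_trans a _|apply: le_lt_trans b _]; rewrite ltrDl.
Qed.

Lemma continuous_compact_le f K : continuous f -> compact K ->
  exists C : R, forall x, K x -> `|f x| <= C.
Proof.
move=> cf cK; have : compact (f @` K).
  by apply: continuous_compact => //; exact: continuous_subspaceT.
move=> /compact_bounded[M [_ HM]]; exists (`|M| + 1) => x Kx.
apply: HM; first by rewrite (le_lt_trans (ler_norm _)) // ltrDl.
by exists x.
Qed.

Lemma crect_compact q : compact (@crect R q).
Proof. by apply: compact_setX; exact: segment_compact. Qed.

Lemma leb2_crect_fin q : (leb2 R (crect q) < +oo)%E.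
Proof.
rewrite /crect product_measure1E; [|exact: measurable_itv..].
have fin (a b : R) : ((@lebesgue_measure R) `[a, b]%classic < +oo)%E.
  by rewrite lebesgue_measure_itv /=; case: ifP => _; rewrite -?EFinB ltry.
apply: lte_mul_pinfty; [exact: measure_ge0| |exact: fin].
by rewrite ge0_fin_numE; [exact: fin|exact: measure_ge0].
Qed.

Let box (r : R) := crect ((- r, r), (- r, r)).

Let measurable_box r : measurable (box r : set (plane R)).
Proof. by apply: measurableX; exact: measurable_itv. Qed.

Lemma continuous_compact_integrable2 g K : continuous g -> compact K ->
  (forall x, ~ K x -> g x = 0) -> (leb2 R).-integrable [set: plane R] (EFin \o g).
Proof.
move=> cg cK g0; have [r r0 Kr] := compact_subset_box cK.
have [C gC] := continuous_compact_le cg cK.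
have gb : L1 (leb2 R) (box r) g.
  apply: (@L1_bounded _ _ _ _ _ (measurable_box r) (leb2_crect_fin _) _ `|C|).
    exact: measurable_funTS (continuous_measurable2 cg).
  move=> x _; have [Kx|/g0 ->] := pselect (K x); last by rewrite normr0.
  by rewrite (le_trans (gC _ Kx)) // ler_norm.
have := (integrable_mkcond _ (measurable_box r)).1 gb.
congr (is_true (_.-integrable _ _)); apply/funext => x; rewrite patchE /=.
case: ifPn => // /negP xb; rewrite g0 // => /Kr[x1 x2]; apply: xb.
by rewrite inE; split; rewrite /= in_itv /= -ler_norml ltW.
Qed.

Let integral_line eta K i (x : R * R) : C1 eta -> compact K ->
  (forall x, ~ K x -> eta x = 0) -> pcoord i x = 0 ->
  (\int[@lebesgue_measure R]_t (pderiv i eta (t *: basis2 R i + x))%:E = 0)%E.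
Proof.
move=> Ce cK e0 xi; have [r r0 Kr] := compact_subset_box cK.
pose f t := pderiv i eta (t *: basis2 R i + x).
pose F t := eta (t *: basis2 R i + x).
have cl : continuous (fun t : R => t *: basis2 R i + x).
  move=> t; apply: cvgD; last exact: cvg_cst.
  by apply: cvgZl; exact: cvg_id.
have out t : r <= `|t| -> ~ K (t *: basis2 R i + x).
  move=> rt /Kr[]; move: xi; rewrite /pcoord /basis2.
  case: i {f F cl} => -[|[|//]] /= _ ->; rewrite [_%:A]mulr1 addr0.
    by rewrite ltNge rt.
  by move=> _; rewrite ltNge rt.
have cf : continuous f.
  move=> t; apply: continuous_comp; first exact: cl.
  exact: (Cdir_continuous (C1_pderiv i Ce)).
have dF t : is_derive t (1 : R) F (f t).
  by apply: is_derive_along_line; exact: (C1_derivable Ce).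
have cF : continuous F.
  move=> t; apply: continuous_comp; first exact: cl.
  exact: (Cdir_continuous Ce).
rewrite (_ : \int[_]_t _ = \int[@lebesgue_measure R]_(t in `[(- r)%R, r]%classic) (f t)%:E)%E; last first.
  rewrite [RHS]integral_mkcond; apply: eq_integral => t _; rewrite patchE.
  case: ifPn => // /negP tr; rewrite (pderiv_out i (compact_closed2 cK) e0) //.
  apply: out; rewrite leNgt; apply/negP => tr'; apply: tr.
  by rewrite inE /= in_itv /= -ler_norml ltW.
rewrite (@continuous_FTC2 _ f F) //.
- rewrite /F !e0 ?subee //; apply: out; rewrite ?normrN gtr0_norm //.
- by rewrite -subr_gt0 opprK addr_gt0.
- exact: continuous_subspaceT.
- split=> [t _||].
  + by have [] := dF t.
  + exact/cvg_at_right_filter/cF.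
  + exact/cvg_at_left_filter/cF.
- by move=> t _; rewrite derive1E; have [_ ->] := dF t.
Qed.

(** Fubini's theorem reduces this to lines parallel to an axis, on which it is
    the fundamental theorem of calculus. *)
Lemma integral_pderiv0 eta K Omega i : C1 eta -> compact K -> K `<=` Omega ->
  (forall x, ~ K x -> eta x = 0) ->
  \int[leb2 R]_(x in Omega) pderiv i eta x = 0.
Proof.
move=> Ce cK KO e0; have cc : closed K by exact: compact_closed2.
have g0 := pderiv_out i cc e0.
rewrite Rintegral_mkcond (_ : _ \_ Omega = pderiv i eta); last first.
  apply/funext => x; rewrite patchE; case: ifPn => // /negP xO.
  by rewrite g0 // => /KO Ox; apply: xO; rewrite inE.
have ig := continuous_compact_integrable2 (Cdir_continuous (C1_pderiv i Ce)) cK g0.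
rewrite /Rintegral; have [i0|i1] := eqVneq i 0.
  rewrite -(integral21_prod_meas1 ig).
  rewrite (eq_integral (cst 0%E)) ?integral0 // => y _.
  have y0 : pcoord i (0, y) = 0 by rewrite i0.
  apply: (etrans _ (integral_line Ce cK e0 y0)); rewrite /fubini_G i0.
  apply: eq_integral => t _ /=; congr (pderiv _ _ _)%:E.
  by rewrite /basis2 /=; congr (_, _); rewrite /= ?[_%:A]mulr1 ?scaler0 ?addr0 ?add0r.
rewrite -(integral12_prod_meas1 ig).
rewrite (eq_integral (cst 0%E)) ?integral0 // => y _.
have i1' : i = 1 by apply/val_inj; case: i i1 {Ce g0 ig} => -[|[|]].
have y0 : pcoord i (y, 0) = 0 by rewrite i1'.
apply: (etrans _ (integral_line Ce cK e0 y0)); rewrite /fubini_F i1'.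
apply: eq_integral => t _ /=; congr (pderiv _ _ _)%:E.
by rewrite /basis2 /=; congr (_, _); rewrite /= ?[_%:A]mulr1 ?scaler0 ?addr0 ?add0r.
Qed.

End by_parts.

Section null_lagrangian.
Context (R : realType).
Implicit Types (f g p theta : R * R -> R) (K Omega : set (R * R)).

Notation C1 := (Cdir (basis2 R) 1).
Notation C2 := (Cdir (basis2 R) 2).

Lemma norm_basis2 i : `|basis2 R i| <= 1.
Proof.
rewrite [leLHS]/Num.norm /= ge_max /basis2 /=.
by case: (i == 0); case: (i == 1); rewrite /= ?normr1 ?normr0 ?ler01 ?lexx.
Qed.

(** The mean value theorem is used twice, first in the direction [u] and then in
    the direction [v]. *)
Let second_difference theta i j (a : R * R) (h : R) : C2 theta -> 0 < h ->
  let u := basis2 R i in let v := basis2 R j in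
  exists2 q : R * R, `|q - a| <= h + h &
  theta (h *: u + (h *: v + a)) - theta (h *: u + a) - theta (h *: v + a) + theta a =
  pderiv j (pderiv i theta) q * h * h.
Proof.
move=> Ct h0 u v.
pose g s := theta (s *: u + (h *: v + a)) - theta (s *: u + a).
pose dg s := pderiv i theta (s *: u + (h *: v + a)) - pderiv i theta (s *: u + a).
have dth x : derivable theta x u by exact: (C1_derivable Ct).
have dG s : is_derive s (1 : R) g (dg s).
  by apply: is_deriveB; exact: is_derive_along_line.
have cG : continuous g.
  by move=> s; apply/differentiable_continuous/derivable1_diffP; have [] := dG s.
have [xi xih Exi] := MVT h0 (fun s _ => dG s) (continuous_subspaceT cG).
pose k t := pderiv i theta (t *: v + (xi *: u + a)).
have C1t : C1 (pderiv i theta) by exact: C1_pderiv.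
have dK t : is_derive t (1 : R) k (pderiv j (pderiv i theta) (t *: v + (xi *: u + a))).
  by apply: is_derive_along_line; exact: (C1_derivable C1t).
have cK : continuous k.
  by move=> s; apply/differentiable_continuous/derivable1_diffP; have [] := dK s.
have [eta etah Eeta] := MVT h0 (fun s _ => dK s) (continuous_subspaceT cK).
exists (eta *: v + (xi *: u + a)).
  rewrite addrA addrK; apply: le_trans (ler_normD _ _) _.
  move: xih etah; rewrite !in_itv /= => /andP[x0 xh] /andP[e0 eh].
  rewrite !normrZ (gtr0_norm x0) (gtr0_norm e0).
  by apply: lerD; rewrite -[leRHS]mulr1; apply: ler_pM => //; try exact: ltW; exact: norm_basis2.
move: Exi Eeta; rewrite /g /dg /k !scale0r !add0r subr0 => Exi Eeta.
rewrite -Eeta -[h *: v + (xi *: u + a)]addrCA -Exi; ring.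
Qed.

Let symmetric_difference theta i j (a : R * R) (h : R) : C2 theta -> 0 < h ->
  exists q1 q2 : R * R, [/\ `|q1 - a| <= h + h, `|q2 - a| <= h + h &
    pderiv j (pderiv i theta) q1 = pderiv i (pderiv j theta) q2].
Proof.
move=> Ct h0; have [q1 q1a E1] := second_difference i j a Ct h0.
have [q2 q2a E2] := second_difference j i a Ct h0.
move: (pderiv j (pderiv i theta)) (pderiv i (pderiv j theta)) E1 E2 => P Q E1.
rewrite addrCA => E2; exists q1, q2; split => //.
have hn0 : h != 0 by rewrite gt_eqF.
apply: (mulIf hn0); apply: (mulIf hn0); rewrite -{}E1 -{}E2.
by congr (_ + _); rewrite addrAC.
Qed.

(** Schwarz's theorem: both iterated derivatives are limits of the same
    second difference quotient. *)
Lemma pderivC theta i j : C2 theta -> pderiv j (pderiv i theta) = pderiv i (pderiv j theta).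
Proof.
move=> Ct; apply/funext => a; apply/eqP; rewrite -subr_eq0 -normr_eq0.
set A := pderiv j _ a; set B := pderiv i _ a.
rewrite eq_le normr_ge0 andbT; apply/ler_addgt0Pr => e e0; rewrite add0r.
have e20 : 0 < e / 2 by rewrite divr_gt0.
have cont i' j' : continuous (pderiv j' (pderiv i' theta)).
  exact: Cdir_continuous (C1_pderiv _ (C1_pderiv _ Ct)).
have near_ i' j' : exists2 d : R, 0 < d & forall q, `|q - a| < d ->
    `|pderiv j' (pderiv i' theta) a - pderiv j' (pderiv i' theta) q| <= e / 2.
  have := cont i' j' a; move=> /cvgrPdist_le/(_ _ e20) H.
  have [d /= d0 Hd] := (nbhs_ballP _ _).1 H.
  by exists d => // q qd; apply: Hd; rewrite -ball_normE /= distrC.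
have [d1 d10 H1] := near_ i j; have [d2 d20 H2] := near_ j i.
pose m := Num.min d1 d2; pose h := m / 3.
have m0 : 0 < m by rewrite lt_min d10 d20.
have [h0 hm] : 0 < h /\ h + h < m by rewrite /h; move: m0; clear; move: m => m m0; split; lra.
have [q1 [q2 [q1a q2a E]]] := symmetric_difference i j a Ct h0.
move: (pderiv j (pderiv i theta)) (pderiv i (pderiv j theta)) @A @B H1 H2 E {cont near_} => P Q A B H1 H2 E.
have h1 : `|A - P q1| <= e / 2.
  by apply/H1/(le_lt_trans q1a)/(lt_le_trans hm); rewrite ge_min lexx.
have h2 : `|B - Q q2| <= e / 2.
  by apply/H2/(le_lt_trans q2a)/(lt_le_trans hm); rewrite ge_min lexx orbT.
rewrite (le_trans (ler_distD (Q q2) _ _)) // [leRHS]splitr lerD // -?E //.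
by rewrite E distrC.
Qed.

(** The density of [df /\ dg], that is, the Jacobian of the map [(f, g)]. *)
Definition wedge f g x := pderiv 0 f x * pderiv 1 g x - pderiv 1 f x * pderiv 0 g x.

Lemma pderiv_comp (a : R -> R) f i x : Cdir (unitdir R) 1 a -> C1 f ->
  pderiv i (a \o f) x = 'D_1 a (f x) * pderiv i f x.
Proof.
move=> [_ /(_ tt)[da _]] Cf; rewrite /pderiv.
by have [_ ->] := derive_comp_dir (da (f x)) (@C1_derivable _ _ _ i x Cf).
Qed.

Lemma wedge_comp (a b : R -> R) f g x :
  Cdir (unitdir R) 1 a -> Cdir (unitdir R) 1 b -> C1 f -> C1 g ->
  wedge (a \o f) (b \o g) x = 'D_1 a (f x) * 'D_1 b (g x) * wedge f g x.
Proof. by move=> Ca Cb Cf Cg; rewrite /wedge !pderiv_comp //; ring. Qed.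

Lemma pderivM f g i x : C1 f -> C1 g ->
  pderiv i (f \* g) x = f x * pderiv i g x + g x * pderiv i f x.
Proof.
move=> Cf Cg; have df := @C1_derivable _ _ _ i x Cf; have dg := @C1_derivable _ _ _ i x Cg.
exact: (deriveM df dg).
Qed.

Lemma pderivB f g i x : C1 f -> C1 g ->
  pderiv i (f \- g) x = pderiv i f x - pderiv i g x.
Proof.
move=> Cf Cg; have df := @C1_derivable _ _ _ i x Cf; have dg := @C1_derivable _ _ _ i x Cg.
exact: (deriveB df dg).
Qed.

(** The Jacobian is a null Lagrangian: it is the divergence of
    [(p * pderiv 1 theta, - p * pderiv 0 theta)]. *)
Lemma integral_wedge0 p theta K Omega : C2 p -> C2 theta -> open Omega ->
  compact K -> K `<=` Omega -> (forall x, ~ K x -> p x = 0) ->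
  \int[leb2 R]_(x in Omega) wedge p theta x = 0.
Proof.
move=> Cp Ct oO cK KO p0.
have C1p : C1 p by exact: CdirW.
have C1t i : C1 (pderiv i theta) by exact: C1_pderiv.
pose eta i := p \* pderiv i theta.
have Ceta i : C1 (eta i) by exact: CdirM.
have eta0 i x : ~ K x -> eta i x = 0 by move=> Kx; rewrite /eta /= p0 // mul0r.
have int i j : (leb2 R).-integrable (Omega : set (plane R)) (EFin \o pderiv i (eta j)).
  apply: (@integrableS _ _ _ (leb2 R) setT) => //; first exact: open_measurable2.
  apply: (continuous_compact_integrable2 _ cK).
    exact: Cdir_continuous (C1_pderiv i (Ceta j)).
  by apply: pderiv_out (eta0 j); exact: compact_closed2.
rewrite (_ : Rintegral _ _ _ = \int[leb2 R]_(x in Omega) (pderiv 0 (eta 1) x - pderiv 1 (eta 0) x)).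
  rewrite RintegralB //; last exact: open_measurable2.
  have E i j : \int[leb2 R]_(x in Omega) pderiv i (eta j) x = 0.
    exact: (integral_pderiv0 i (Ceta j) cK KO (eta0 j)).
  transitivity (0 - 0 : R); last exact: subrr.
  by congr (_ - _); exact: E.
apply: eq_Rintegral => x _; rewrite !pderivM // (pderivC 0 1 Ct) /wedge; ring.
Qed.

Definition tensor (a b : R -> R) (y : R * R) : R := a y.1 * b y.2.

Lemma Cdir_tensor k (a b : R -> R) : Cdir (unitdir R) k a -> Cdir (unitdir R) k b ->
  Cdir (basis2 R) k (tensor a b).
Proof.
move=> Ca Cb; apply: (@CdirM _ _ _ _ _ (a \o pcoord 0) (b \o pcoord 1));
  by apply: Cdir_comp => //; exact: Cdir_pcoord.
Qed.

Lemma tensor_out n (a b a' b' : R) x : ~ crect ((a, b), (a', b')) x ->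
  tensor (plateau n a b) (plateau n a' b') x = 0.
Proof.
move=> nx; rewrite /tensor.
have [xa|xa] := pselect (`[a, b]%classic x.1); last by rewrite plateau_out_cc ?mul0r.
by rewrite [X in _ * X]plateau_out_cc ?mulr0 // => xb; apply: nx.
Qed.

Lemma test_tensor Omega n (a b a' b' : R) : crect ((a, b), (a', b')) `<=` Omega ->
  test_function Omega (tensor (plateau n a b) (plateau n a' b')).
Proof.
move=> qO; split; first by move=> k; apply/CkE; apply: Cdir_tensor; exact: Cdir_plateau.
exists (crect ((a, b), (a', b'))); split=> //; first exact: crect_compact.
by move=> x; exact: tensor_out.
Qed.

Lemma pderiv_tensor (a b : R -> R) m y : Cdir (unitdir R) 1 a -> Cdir (unitdir R) 1 b ->
  pderiv m (tensor a b) y =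
  if m == 0 then tensor ('D_1 a) b y else tensor a ('D_1 b) y.
Proof.
move=> Ca Cb.
have C0 : Cdir (basis2 R) 1 (a \o pcoord 0) by apply: Cdir_comp => //; exact: Cdir_pcoord.
have C1' : Cdir (basis2 R) 1 (b \o pcoord 1) by apply: Cdir_comp => //; exact: Cdir_pcoord.
rewrite (_ : pderiv m (tensor a b) y = pderiv m ((a \o pcoord 0) \* (b \o pcoord 1)) y) //.
rewrite (pderivM m y C0 C1') (pderiv_comp m y Ca (@Cdir_pcoord R 1 0)).
rewrite (pderiv_comp m y Cb (@Cdir_pcoord R 1 1)) !pderiv_pcoord.
case: m => -[|[|//]] p /=; rewrite /tensor /pcoord /=; ring.
Qed.

(** In [d(a(f) b(g))] only the term with [df] survives a product with [dg], and
    only the term with [dg] a product with [df]. The factors [1] and [- 1] give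
    both identities the form that [integral_coord_jacobian] expects. *)
Lemma wedge_tensor (a b : R -> R) (f g : R * R -> R) x :
  Cdir (unitdir R) 1 a -> Cdir (unitdir R) 1 b ->
  Cdir (basis2 R) 1 f -> Cdir (basis2 R) 1 g ->
  wedge ((a \o f) \* (b \o g)) g x = 1 * tensor ('D_1 a) b (f x, g x) * wedge f g x /\
  wedge ((a \o f) \* (b \o g)) f x = - 1 * tensor a ('D_1 b) (f x, g x) * wedge f g x.
Proof.
move=> Ca Cb Cf Cg.
have C0 : Cdir (basis2 R) 1 (a \o f) by exact: Cdir_comp.
have C1' : Cdir (basis2 R) 1 (b \o g) by exact: Cdir_comp.
rewrite /wedge !(pderivM _ x C0 C1') !(pderiv_comp _ x Ca Cf) !(pderiv_comp _ x Cb Cg).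
rewrite /tensor /=.
move: (pderiv 0 f x) (pderiv 1 f x) (pderiv 0 g x) (pderiv 1 g x) => *.
by split; ring.
Qed.

End null_lagrangian.

(** * Change of variables for limits of smooth maps *)

Section jacobian_limits.
Context (R : realType) (Omega B : set (R * R)).
Hypotheses (oO : open Omega) (muO : (leb2 R Omega < +oo)%E)
  (cB : compact B) (OB : Omega `<=` B).
Implicit Types (u v f g : R * R -> R) (p q : 'I_2 -> R * R -> R).

Let mO : measurable (Omega : set (plane R)).
Proof. exact: open_measurable2. Qed.

Lemma continuous_L2 f : continuous f -> L2 (leb2 R) Omega f.
Proof.
move=> cf; have [C HC] := continuous_compact_le cf cB.
apply: (L2_bounded mO muO (C := C)); last by move=> x /OB; exact: HC.
exact: measurable_funTS (continuous_measurable2 cf).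
Qed.

Lemma continuous_L1 f : continuous f -> L1 (leb2 R) Omega f.
Proof. by move=> cf; apply: L2_L1 => //; exact: continuous_L2. Qed.

(** The counterpart of [wedge] for functions known through their weak gradients
    [p] and [q]. *)
Definition jac p q x : R := p 0 x * q 1 x - p 1 x * q 0 x.

Lemma wedge_continuous u v : Cdir (basis2 R) 1 u -> Cdir (basis2 R) 1 v ->
  continuous (wedge u v).
Proof.
move=> Cu Cv.
have cu i : continuous (pderiv i u) by exact: Cdir_continuous (C1_pderiv i Cu).
have cv i : continuous (pderiv i v) by exact: Cdir_continuous (C1_pderiv i Cv).
by move=> x; apply: cvgB; apply: cvgM; [exact: cu|exact: cv|exact: cu|exact: cv].
Qed.

Lemma jac_L1 p q : (forall i, L2 (leb2 R) Omega (p i)) ->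
  (forall i, L2 (leb2 R) Omega (q i)) -> L1 (leb2 R) Omega (jac p q).
Proof. by move=> p2 q2; apply: L1B => //; apply: L2_mul. Qed.

(** A Jacobian is bilinear in the gradients, hence continuous from [L^2] to
    [L^1]. *)
Lemma cvgL1_wedge (u_ v_ : nat -> R * R -> R) p q :
  (forall n, Cdir (basis2 R) 1 (u_ n)) -> (forall n, Cdir (basis2 R) 1 (v_ n)) ->
  (forall i, L2 (leb2 R) Omega (p i)) -> (forall i, L2 (leb2 R) Omega (q i)) ->
  (forall i, cvgL2 (leb2 R) Omega (fun n => pderiv i (u_ n)) (p i)) ->
  (forall i, cvgL2 (leb2 R) Omega (fun n => pderiv i (v_ n)) (q i)) ->
  cvgL1 (leb2 R) Omega (fun n => wedge (u_ n) (v_ n)) (jac p q).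
Proof.
move=> Cu Cv p2 q2 cu cv.
have du i n : L2 (leb2 R) Omega (pderiv i (u_ n)).
  exact: continuous_L2 (Cdir_continuous (C1_pderiv i (Cu n))).
have dv i n : L2 (leb2 R) Omega (pderiv i (v_ n)).
  exact: continuous_L2 (Cdir_continuous (C1_pderiv i (Cv n))).
have c01 := cvgL2_mul mO (du 0) (dv 1) (p2 0) (q2 1) (cu 0) (cv 1).
have c10 := cvgL2_mul mO (du 1) (dv 0) (p2 1) (q2 0) (cu 1) (cv 0).
have l1 i j n : L1 (leb2 R) Omega (fun x => pderiv i (u_ n) x * pderiv j (v_ n) x - p i x * q j x).
  by apply: L1B => //; exact: L2_mul.
apply: (cvgL1_squeeze (u := fun n =>
   \int[leb2 R]_(x in Omega) `|pderiv 0 (u_ n) x * pderiv 1 (v_ n) x - p 0 x * q 1 x| +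
   \int[leb2 R]_(x in Omega) `|pderiv 1 (u_ n) x * pderiv 0 (v_ n) x - p 1 x * q 0 x|)).
  move=> n; have a1 := L1_norm (l1 0 1 n); have a2 := L1_norm (l1 1 0 n).
  rewrite -RintegralD //; apply: le_int_norm => //.
  - apply: L1B => //; last exact: jac_L1.
    by apply: continuous_L1; exact: wedge_continuous.
  - exact: L1D.
  - move=> x _; rewrite /wedge /jac.
    move: (pderiv 0 _ x) (pderiv 1 (v_ n) x) (pderiv 1 (u_ n) x) (pderiv 0 (v_ n) x).
    move: (p 0 x) (q 1 x) (p 1 x) (q 0 x) => a b c d a' b' c' d'.
    rewrite (_ : _ - _ = (a' * b' - a * b) - (c' * d' - c * d)); last by ring.
    exact: ler_normB.
rewrite -[X in _ --> X](addr0 0); exact: cvgD.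
Qed.

(** The [f_ n] only converge in mean square, so [a] and [b] are Lipschitz: then [tensor a b] of [f_ n] converges in mean, while staying
    bounded, and [cvg_int_mul] applies. *)
Lemma cvg_int_tensor (f_ : nat -> 'I_2 -> R * R -> R) (F : R * R -> R * R)
    (rho : R * R -> R) (a b : R -> R) (w_ : nat -> R * R -> R) w :
  (forall n j, continuous (f_ n j)) ->
  (forall j, L2 (leb2 R) Omega (pcoord j \o F)) ->
  (forall j, cvgL2 (leb2 R) Omega (fun n => f_ n j) (pcoord j \o F)) ->
  continuous rho -> continuous a -> continuous b ->
  bounded_lipschitz a -> bounded_lipschitz b ->
  (forall n, L1 (leb2 R) Omega (w_ n)) -> L1 (leb2 R) Omega w ->
  cvgL1 (leb2 R) Omega w_ w ->
  (fun n => \int[leb2 R]_(x in Omega)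
     ((rho x * tensor a b (f_ n 0 x, f_ n 1 x)) * w_ n x)) @ \oo -->
  \int[leb2 R]_(x in Omega) ((rho x * tensor a b (F x)) * w x).
Proof.
move=> cf F2 cF crho ca cb [Ca [Ca0 Ca1]] [Cb [Cb0 Cb1]] w_1 w1 cw.
have [Cr HCr] := continuous_compact_le crho cB.
have Cr0 x : Omega x -> `|rho x| <= `|Cr|.
  by move=> /OB/HCr h; rewrite (le_trans h) // ler_norm.
have Ca_ge0 : 0 <= Ca by rewrite (le_trans _ (Ca0 0)).
have Cb_ge0 : 0 <= Cb by rewrite (le_trans _ (Cb0 0)).
have ch n : continuous (fun x => rho x * tensor a b (f_ n 0 x, f_ n 1 x)).
  move=> x; apply: cvgM; first exact: crho.
  apply: cvgM; apply: continuous_comp; [exact: cf|exact: ca|exact: cf|exact: cb].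
have mh : measurable_fun (Omega : set (plane R)) (fun x => rho x * tensor a b (F x)).
  apply: measurable_funM.
    exact: measurable_funTS (continuous_measurable2 crho).
  apply: measurable_funM.
    by apply: (measurableT_comp (continuous_measurable_fun ca)); have [] := F2 0.
  by apply: (measurableT_comp (continuous_measurable_fun cb)); have [] := F2 1.
have bnd x y : Omega x -> `|rho x * tensor a b y| <= `|Cr| * (Ca * Cb).
  move=> Ox; rewrite /tensor !normrM; apply: ler_pM => //; first exact: Cr0.
  by apply: ler_pM.
apply: (cvg_int_mul mO muO _ mh (C := `|Cr| * (Ca * Cb))) => //.
- by move=> n; exact: measurable_funTS (continuous_measurable2 (ch n)).
- by move=> n x; exact: bnd.
- by move=> x; exact: bnd.
have f2 n j : L2 (leb2 R) Omega (f_ n j) by exact: continuous_L2.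
have cF1 j : cvgL1 (leb2 R) Omega (fun n => f_ n j) (pcoord j \o F).
  by apply: cvgL2_L1.
pose c := `|Cr| * (Ca * Cb).
apply: (cvgL1_squeeze (u := fun n =>
    c * \int[leb2 R]_(x in Omega) `|f_ n 0 x - (F x).1| +
    c * \int[leb2 R]_(x in Omega) `|f_ n 1 x - (F x).2|)).
  move=> n.
  have d0 : L1 (leb2 R) Omega (fun x => `|f_ n 0 x - (F x).1|).
    exact: L1_norm (L1B mO (L2_L1 mO muO (f2 n 0)) (L2_L1 mO muO (F2 0))).
  have d1 : L1 (leb2 R) Omega (fun x => `|f_ n 1 x - (F x).2|).
    exact: L1_norm (L1B mO (L2_L1 mO muO (f2 n 1)) (L2_L1 mO muO (F2 1))).
  rewrite -!RintegralZl // -RintegralD //; [|exact: L1Z..].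
  apply: le_int_norm => //.
  - apply: L1B => //; first exact: continuous_L1.
    by apply: (L1_bounded mO muO mh (C := c)) => x; exact: bnd.
  - by apply: L1D => //; exact: L1Z.
  move=> x Ox; rewrite -mulrBr normrM -mulrDr /c -mulrA.
  apply: ler_pM => //; first exact: Cr0.
  rewrite /tensor /=.
  set s := f_ n 0 x; set t := f_ n 1 x; set s' := (F x).1; set t' := (F x).2.
  rewrite (_ : _ - _ = (a s - a s') * b t + a s' * (b t - b t')); last by ring.
  apply: le_trans (ler_normD _ _) _; rewrite [leRHS]mulrDr; apply: lerD; rewrite normrM.
    by rewrite mulrAC; apply: ler_pM => //; exact: Ca1.
  by rewrite -mulrA; apply: ler_pM => //; exact: Cb1.
rewrite -[X in _ --> X](addr0 0) -[X in X + _](mulr0 c) -[X in _ + X](mulr0 c).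
by apply: cvgD; apply: cvgM; [exact: cvg_cst|exact: (cF1 0)|exact: cvg_cst|exact: (cF1 1)].
Qed.

End jacobian_limits.

Section change_of_variables.
Context (R : realType) (Omega B : set (R * R)).
Hypotheses (oO : open Omega) (muO : (leb2 R Omega < +oo)%E)
  (cB : compact B) (OB : Omega `<=` B).

Let mO : measurable (Omega : set (plane R)).
Proof. exact: open_measurable2. Qed.

(** The integral of the Jacobian of a map depends only on the boundary values
    of the map. *)
Lemma integral_wedge_eq (U U0 S S0 : R * R -> R) K :
  Cdir (basis2 R) 2 U -> Cdir (basis2 R) 2 U0 ->
  Cdir (basis2 R) 2 S -> Cdir (basis2 R) 2 S0 ->
  compact K -> K `<=` Omega -> (forall x, ~ K x -> U x = U0 x /\ S x = S0 x) ->
  \int[leb2 R]_(x in Omega) wedge U S x = \int[leb2 R]_(x in Omega) wedge U0 S0 x.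
Proof.
move=> CU CU0 CS CS0 cK KO out.
have C1 f : Cdir (basis2 R) 2 f -> Cdir (basis2 R) 1 f by exact: CdirW.
have L f g : Cdir (basis2 R) 2 f -> Cdir (basis2 R) 2 g -> L1 (leb2 R) Omega (wedge f g).
  by move=> Cf Cg; apply: (continuous_L1 oO muO cB OB); apply: wedge_continuous; exact: C1.
have CdU := CdirB CU CU0; have CdS := CdirB CS CS0.
apply/eqP; rewrite -subr_eq0 -RintegralB //; [|exact: L..].
rewrite (_ : Rintegral _ _ _ =
  \int[leb2 R]_(x in Omega) (wedge (U \- U0) S x - wedge (S \- S0) U0 x)); last first.
  apply: eq_Rintegral => x _; rewrite /wedge !pderivB; try exact: C1.
  move: (pderiv 0 U x) (pderiv 1 U x) (pderiv 0 S x) (pderiv 1 S x) (pderiv 0 U0 x)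
    (pderiv 1 U0 x) (pderiv 0 S0 x) (pderiv 1 S0 x) => *; ring.
have E1 : \int[leb2 R]_(x in Omega) wedge (U \- U0) S x = 0.
  by apply: (integral_wedge0 CdU CS oO cK KO) => x /out[/= -> _]; rewrite subrr.
have E2 : \int[leb2 R]_(x in Omega) wedge (S \- S0) U0 x = 0.
  by apply: (integral_wedge0 CdS CU0 oO cK KO) => x /out[/= _ ->]; rewrite subrr.
apply/eqP; apply: (etrans (RintegralB mO (L _ _ CdU CS) (L _ _ CdS CU0))).
transitivity (0 - 0 : R); last exact: subrr.
by congr (_ - _); [exact: E1|exact: E2].
Qed.

(* [P i j] is the [i]-th derivative of [F_j]; the boundary condition on [F] is
   present as an approximation by smooth maps equal to the identity off compact
   subsets of [Omega]. *)
Context (F : R * R -> R * R) (P : 'I_2 -> 'I_2 -> R * R -> R)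
  (f_ : nat -> 'I_2 -> R * R -> R) (K : nat -> set (R * R)).
Hypotheses
  (Cf : forall n j k, Cdir (basis2 R) k (f_ n j))
  (cK : forall n, compact (K n)) (KO : forall n, K n `<=` Omega)
  (fK : forall n j x, ~ K n x -> f_ n j x = pcoord j x)
  (F2 : forall j, L2 (leb2 R) Omega (pcoord j \o F))
  (P2 : forall i j, L2 (leb2 R) Omega (P i j))
  (cF : forall j, cvgL2 (leb2 R) Omega (fun n => f_ n j) (pcoord j \o F))
  (cP : forall i j, cvgL2 (leb2 R) Omega (fun n => pderiv i (f_ n j)) (P i j)).

Let grad j i := P i j.
Let gradcoord (j i : 'I_2) : R * R -> R := cst (j == i)%:R.

Let grad2 j i : L2 (leb2 R) Omega (grad j i). Proof. exact: P2. Qed.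
Let gradcoord2 j i : L2 (leb2 R) Omega (gradcoord j i). Proof. exact: L2_cst. Qed.

Let cgradcoord j i :
  cvgL2 (leb2 R) Omega (fun n => pderiv i (@pcoord R j)) (gradcoord j i).
Proof.
rewrite /cvgL2 (_ : (fun n => _) = cst 0); first exact: cvg_cst.
apply/funext => n; rewrite pderiv_pcoord.
transitivity (\int[leb2 R]_(x in Omega) (0 : R)); last by rewrite Rintegral_cst // mul0r.
by apply: eq_Rintegral => x _; rewrite subrr expr0n.
Qed.

Let c1 n j := Cf n j 1. Let c2 n j := Cf n j 2.

(** With primitives [A] and [S] of the two plateaus, the integrand for a smooth
    approximation [f_ m] is the Jacobian of [(A \o f_ m 0, S \o f_ m 1)], whose
    integral only depends on boundary values. *)
Lemma integral_jacobian_tensor n (a b a' b' : R) :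
  same_integral (leb2 R) Omega Omega F (jac (grad 0) (grad 1)) (cst 1)
    (fun y => plateau n a b y.1 * plateau n a' b' y.2).
Proof.
pose al := plateau n a b; pose be := plateau n a' b'.
have Ca k : Cdir (unitdir R) k al by exact: Cdir_plateau.
have Cb k : Cdir (unitdir R) k be by exact: Cdir_plateau.
have ca := Cdir_continuous (Ca 0%N); have cb := Cdir_continuous (Cb 0%N).
have a0 t : ~ `[a, b]%classic t -> al t = 0 by exact: plateau_out_cc.
have b0 t : ~ `[a', b']%classic t -> be t = 0 by exact: plateau_out_cc.
have [A dA] := exists_primitive ca a0; have [S dS] := exists_primitive cb b0.
have CA k : Cdir (unitdir R) k A by apply: CdirW; exact: CdirS_primitive (Ca k) dA.
have CS k : Cdir (unitdir R) k S by apply: CdirW; exact: CdirS_primitive (Cb k) dS.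
have DA t : 'D_1 A t = al t by have [] := dA t.
have DS t : 'D_1 S t = be t by have [] := dS t.
have E m : \int[leb2 R]_(x in Omega)
    ((cst 1 x * tensor al be (f_ m 0 x, f_ m 1 x)) * wedge (f_ m 0) (f_ m 1) x) =
    \int[leb2 R]_(x in Omega) (al x.1 * be x.2 * cst 1 x).
  transitivity (\int[leb2 R]_(x in Omega) wedge (A \o f_ m 0) (S \o f_ m 1) x).
    apply: eq_Rintegral => x _.
    rewrite (wedge_comp x (CA 1%N) (CS 1%N) (c1 m 0) (c1 m 1)) DA DS /tensor /=.
    by rewrite mul1r.
  transitivity (\int[leb2 R]_(x in Omega) wedge (A \o pcoord 0) (S \o pcoord 1) x); last first.
    apply: eq_Rintegral => x _.
    rewrite (wedge_comp x (CA 1%N) (CS 1%N) (@Cdir_pcoord R 1 0) (@Cdir_pcoord R 1 1)) DA DS.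
    by rewrite /wedge !pderiv_pcoord /= mulr0 subr0 !mulr1.
  apply: (@integral_wedge_eq _ _ _ _ (K m)) => //.
  - exact: Cdir_comp.
  - by apply: Cdir_comp => //; exact: Cdir_pcoord.
  - exact: Cdir_comp.
  - by apply: Cdir_comp => //; exact: Cdir_pcoord.
  - by move=> x nK /=; rewrite !fK.
have cw := cvgL1_wedge oO muO cB OB (c1^~ 0) (c1^~ 1) (grad2 0) (grad2 1) (cP^~ 0) (cP^~ 1).
have w1 : L1 (leb2 R) Omega (jac (grad 0) (grad 1)) by exact: jac_L1.
have w_1 m : L1 (leb2 R) Omega (wedge (f_ m 0) (f_ m 1)).
  by apply: (continuous_L1 oO muO cB OB); exact: wedge_continuous.
have bla := C1_bounded_lipschitz (Ca 1) a0; have blb := C1_bounded_lipschitz (Cb 1) b0.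
have crho : continuous (cst 1 : R * R -> R) by move=> x; exact: cvg_cst.
have cf m j := Cdir_continuous (Cf m j 0).
have lim := cvg_int_tensor oO muO cB OB cf F2 cF crho ca cb bla blb w_1 w1 cw.
rewrite /same_integral.
transitivity (\int[leb2 R]_(x in Omega) (cst 1 x * tensor al be (F x) * jac (grad 0) (grad 1) x)).
  by apply: eq_Rintegral => x _; rewrite /= mul1r.
by rewrite (funext E) in lim; exact: (cvg_unique _ lim (cvg_cst _)).
Qed.

(** Stokes' theorem for the form [x_i phi(f_ m) df_(m, m')], where [phi] is the
    product of the plateaus [al] and [be], followed by the limit of large [m].
    The last hypothesis expresses [d(phi(f_ m)) /\ df_(m, m')] by a partial
    derivative of [phi] and the Jacobian of [f_ m]. *)
Lemma integral_coord_jacobian n (a b a' b' : R) i m' (a1 b1 : R -> R) (sg : R) :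
  let al := plateau n a b in let be := plateau n a' b' in
  crect ((a, b), (a', b')) `<=` Omega ->
  continuous a1 -> continuous b1 -> bounded_lipschitz a1 -> bounded_lipschitz b1 ->
  (forall m x, wedge ((al \o f_ m 0) \* (be \o f_ m 1)) (f_ m m') x =
     sg * tensor a1 b1 (f_ m 0 x, f_ m 1 x) * wedge (f_ m 0) (f_ m 1) x) ->
  sg * \int[leb2 R]_(x in Omega)
    ((pcoord i x * tensor a1 b1 (F x)) * jac (grad 0) (grad 1) x) =
  - \int[leb2 R]_(x in Omega) (tensor al be (F x) * jac (gradcoord i) (grad m') x).
Proof.
move=> al be qO ca1 cb1 la1 lb1 Ew.
have Ca k : Cdir (unitdir R) k al by exact: Cdir_plateau.
have Cb k : Cdir (unitdir R) k be by exact: Cdir_plateau.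
have ca := Cdir_continuous (Ca 0%N); have cb := Cdir_continuous (Cb 0%N).
have la : bounded_lipschitz al by apply: C1_bounded_lipschitz (Ca 1%N) _ => t; exact: plateau_out_cc.
have lb : bounded_lipschitz be by apply: C1_bounded_lipschitz (Cb 1%N) _ => t; exact: plateau_out_cc.
have Cx k := @Cdir_pcoord R k i.
have cf m j := Cdir_continuous (Cf m j 0).
have crho : continuous (cst 1 : R * R -> R) by move=> x; exact: cvg_cst.
have w1 : L1 (leb2 R) Omega (jac (grad 0) (grad 1)) by exact: jac_L1.
have w_1 m : L1 (leb2 R) Omega (wedge (f_ m 0) (f_ m 1)).
  by apply: (continuous_L1 oO muO cB OB); exact: wedge_continuous.
have v1 : L1 (leb2 R) Omega (jac (gradcoord i) (grad m')) by exact: jac_L1.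
have v_1 m : L1 (leb2 R) Omega (wedge (pcoord i) (f_ m m')).
  by apply: (continuous_L1 oO muO cB OB); exact: wedge_continuous.
have cw := cvgL1_wedge oO muO cB OB (c1^~ 0) (c1^~ 1) (grad2 0) (grad2 1) (cP^~ 0) (cP^~ 1).
have cv := cvgL1_wedge oO muO cB OB (fun=> Cx 1%N) (c1^~ m') (gradcoord2 i) (grad2 m')
  (cgradcoord i) (cP^~ m').
have lim1 := cvg_int_tensor oO muO cB OB cf F2 cF (@pcoord_continuous R i) ca1 cb1 la1 lb1 w_1 w1 cw.
have lim2 := cvg_int_tensor oO muO cB OB cf F2 cF crho ca cb la lb v_1 v1 cv.
have E m : sg * \int[leb2 R]_(x in Omega) ((pcoord i x * tensor a1 b1 (f_ m 0 x, f_ m 1 x)) *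
      wedge (f_ m 0) (f_ m 1) x) =
    - \int[leb2 R]_(x in Omega) ((cst 1 x * tensor al be (f_ m 0 x, f_ m 1 x)) *
      wedge (pcoord i) (f_ m m') x).
  pose phi := (al \o f_ m 0) \* (be \o f_ m 1).
  have Cphi k : Cdir (basis2 R) k phi by apply: CdirM; apply: Cdir_comp.
  have Cp k : Cdir (basis2 R) k (pcoord i \* phi) by exact: CdirM.
  have int0 : \int[leb2 R]_(x in Omega) wedge (pcoord i \* phi) (f_ m m') x = 0.
    have cKq : compact (K m `|` crect ((a, b), (a', b'))).
      by apply: compactU; [exact: cK|exact: crect_compact].
    have KqO : K m `|` crect ((a, b), (a', b')) `<=` Omega by rewrite subUset.
    refine (integral_wedge0 (Cp 2%N) (c2 m m') oO cKq KqO _).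
    move=> x /not_orP[nK nq] /=.
    have phi0 : tensor al be x = 0 by exact: tensor_out.
    by rewrite /phi /= !fK // -[X in _ * X]/(tensor al be x) phi0 mulr0.
  have cc1 : continuous (fun x => pcoord i x * tensor a1 b1 (f_ m 0 x, f_ m 1 x)).
    move=> x; apply: cvgM; first exact: pcoord_continuous.
    apply: cvgM; apply: continuous_comp; [exact: cf|exact: ca1|exact: cf|exact: cb1].
  have L1a : L1 (leb2 R) Omega (fun x => (pcoord i x * tensor a1 b1 (f_ m 0 x, f_ m 1 x)) *
      wedge (f_ m 0) (f_ m 1) x).
    apply: (continuous_L1 oO muO cB OB) => x; apply: cvgM; first exact: cc1.
    exact: wedge_continuous.
  have L1b : L1 (leb2 R) Omega (fun x => (cst 1 x * tensor al be (f_ m 0 x, f_ m 1 x)) *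
      wedge (pcoord i) (f_ m m') x).
    apply: (continuous_L1 oO muO cB OB) => x; apply: cvgM.
      by apply: cvgM; [exact: cvg_cst|exact: (Cdir_continuous (Cphi 0%N))].
    exact: wedge_continuous.
  rewrite -(RintegralZl sg mO L1a); apply/eqP; rewrite -addr_eq0 -(RintegralD mO (L1Z mO sg L1a) L1b).
  apply/eqP; rewrite -[RHS]int0; apply: eq_Rintegral => x _.
  have Ex := Ew m x; rewrite -/phi in Ex.
  rewrite [RHS]/wedge !(pderivM _ _ (Cx 1%N) (Cphi 1%N)).
  move: Ex; rewrite /wedge -/(tensor al be (f_ m 0 x, f_ m 1 x)) -[tensor al be _]/(phi x) /= mul1r.
  move: (pderiv 0 phi x) (pderiv 1 phi x) (pderiv 0 (f_ m m') x) (pderiv 1 (f_ m m') x)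
   (phi x) (pcoord i x) (pderiv 0 (pcoord i) x) (pderiv 1 (pcoord i) x) (tensor a1 b1 _)
   (pderiv 0 (f_ m 0) x * _ - _) => p0 p1 g0 g1 ph c x0 x1 T w Ex.
  have -> : (c * p0 + ph * x0) * g1 - (c * p1 + ph * x1) * g0 =
    c * (p0 * g1 - p1 * g0) + ph * (x0 * g1 - x1 * g0) by ring.
  by rewrite Ex; ring.
have lim1' : (fun m => sg * \int[leb2 R]_(x in Omega)
   ((pcoord i x * tensor a1 b1 (f_ m 0 x, f_ m 1 x)) * wedge (f_ m 0) (f_ m 1) x)) @ \oo -->
   sg * \int[leb2 R]_(x in Omega) ((pcoord i x * tensor a1 b1 (F x)) * jac (grad 0) (grad 1) x).
  by apply: cvgM; [exact: cvg_cst|exact: lim1].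
rewrite (funext E) in lim1'.
transitivity (- \int[leb2 R]_(x in Omega)
  ((cst 1 x * tensor al be (F x)) * jac (gradcoord i) (grad m') x)).
  exact: (cvg_unique _ lim1' (cvgN lim2)).
by congr (- _); apply: eq_Rintegral => x _; rewrite [cst 1 x * _]mul1r.
Qed.

(* [G] is the inverse of [F], and [DG m i] is the [m]-th weak derivative of
   [G_i]. *)
Context (G : R * R -> R * R) (DG : 'I_2 -> 'I_2 -> R * R -> R).
Hypotheses (FO : forall x, Omega x -> Omega (F x)) (GO : forall y, Omega y -> Omega (G y))
  (GF : forall x, Omega x -> G (F x) = x) (FG : forall y, Omega y -> F (G y) = y)
  (mG : forall j, measurable_fun (Omega : set (plane R)) (pcoord j \o G))
  (DG2 : forall m i, L2 (leb2 R) Omega (DG m i))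
  (wG : forall m i phi, test_function Omega phi ->
    \int[leb2 R]_(y in Omega) ((pcoord i \o G) y * pderiv m phi y) =
    - \int[leb2 R]_(y in Omega) (DG m i y * phi y)).

Let mF : measurable_fun (Omega : set (plane R)) (F : plane R -> plane R).
Proof. by apply: measurable_fun_plane; [have [] := F2 0|have [] := F2 1]. Qed.

Let mG2 : measurable_fun (Omega : set (plane R)) (G : plane R -> plane R).
Proof. by apply: measurable_fun_plane; [exact: (mG 0)|exact: (mG 1)]. Qed.

(** No count of preimages enters: the formula is inherited from the smooth
    approximations, for which it says that their degree is 1. *)
Lemma integral_jacobian (h : R * R -> R) (C : R) :
  measurable_fun (Omega : set (plane R)) h -> (forall y, Omega y -> `|h y| <= C) ->
  \int[leb2 R]_(x in Omega) (h (F x) * jac (grad 0) (grad 1) x) =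
  \int[leb2 R]_(y in Omega) h y.
Proof.
move=> mh hC.
have w1 : L1 (leb2 R) Omega (jac (grad 0) (grad 1)) by exact: jac_L1.
have v1 : L1 (leb2 R) Omega (cst (1 : R)) by exact: L1_cst.
have := same_bounded mO oO mF FO w1 v1 (fun n a b a' b' _ => integral_jacobian_tensor n a b a' b') mh hC.
rewrite /same_integral => ->.
by apply: eq_Rintegral => y _; rewrite /= mulr1.
Qed.

(** The density is a derivative of [G_i], up to sign. By [integral_jacobian] for
    the function [G_i d_m phi], the left-hand side of [integral_coord_jacobian]
    is the integral of [G_i d_m phi], and the weak derivatives of [G] are
    integrable. *)
Lemma pushforward_coord_wedge i j : exists2 v : R * R -> R, L1 (leb2 R) Omega v &
  forall n a b a' b', crect ((a, b), (a', b')) `<=` Omega ->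
    same_integral (leb2 R) Omega Omega F (jac (gradcoord i) (grad j)) v
      (fun y => plateau n a b y.1 * plateau n a' b' y.2).
Proof.
(* A product with [dF_j] only leaves the derivative of [phi] in the direction
   other than [j]. *)
pose m : 'I_2 := if j == 0 then 1 else 0.
pose sg : R := if j == 0 then -1 else 1.
exists (fun y => sg * DG m i y); first by apply: L1Z => //; exact: L2_L1.
move=> n a b a' b' qO.
pose al := plateau n a b; pose be := plateau n a' b'.
have Ca k : Cdir (unitdir R) k al by exact: Cdir_plateau.
have Cb k : Cdir (unitdir R) k be by exact: Cdir_plateau.
have Ca' k : Cdir (unitdir R) k ('D_1 al) by have [_ /(_ tt)[_]] := Ca k.+1.
have Cb' k : Cdir (unitdir R) k ('D_1 be) by have [_ /(_ tt)[_]] := Cb k.+1.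
have la : bounded_lipschitz al by apply: C1_bounded_lipschitz (Ca 1%N) _ => t; exact: plateau_out_cc.
have lb : bounded_lipschitz be by apply: C1_bounded_lipschitz (Cb 1%N) _ => t; exact: plateau_out_cc.
have la' : bounded_lipschitz ('D_1 al).
  by apply: C1_bounded_lipschitz (Ca' 1%N) (derive_out _) => t; exact: plateau_out_cc.
have lb' : bounded_lipschitz ('D_1 be).
  by apply: C1_bounded_lipschitz (Cb' 1%N) (derive_out _) => t; exact: plateau_out_cc.
have main (a1 b1 : R -> R) : continuous a1 -> continuous b1 ->
  bounded_lipschitz a1 -> bounded_lipschitz b1 ->
  (forall k x, wedge ((al \o f_ k 0) \* (be \o f_ k 1)) (f_ k j) x =
     sg * tensor a1 b1 (f_ k 0 x, f_ k 1 x) * wedge (f_ k 0) (f_ k 1) x) ->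
  (forall y, pderiv m (tensor al be) y = tensor a1 b1 y) ->
  same_integral (leb2 R) Omega Omega F (jac (gradcoord i) (grad j))
    (fun y => sg * DG m i y) (tensor al be).
  move=> ca1 cb1 la1 lb1 Ew Ed.
  have [C1a [Ca1 _]] := la1; have [C1b [Cb1 _]] := lb1.
  have [CB HCB] := continuous_compact_le (@pcoord_continuous R i) cB.
  have mt : measurable_fun [set: plane R] (tensor a1 b1).
    apply: continuous_measurable2 => y; apply: cvgM; apply: continuous_comp;
      [exact: cvg_fst|exact: ca1|exact: cvg_snd|exact: cb1].
  pose h y := (pcoord i \o G) y * tensor a1 b1 y.
  have mh : measurable_fun (Omega : set (plane R)) h.
    by apply: measurable_funM; [exact: mG|exact: measurable_funTS].
  have hC y : Omega y -> `|h y| <= CB * (C1a * C1b).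
    move=> Oy; rewrite normrM; apply: ler_pM => //; first by apply: HCB; apply: OB; exact: GO.
    by rewrite normrM; apply: ler_pM.
  have EA := integral_jacobian mh hC.
  have EB := integral_coord_jacobian i qO ca1 cb1 la1 lb1 Ew.
  have EG := wG m i (test_tensor n qO).
  have E1 : \int[leb2 R]_(x in Omega) ((pcoord i x * tensor a1 b1 (F x)) * jac (grad 0) (grad 1) x) =
     - \int[leb2 R]_(y in Omega) (DG m i y * tensor al be y).
    rewrite -EG (_ : \int[leb2 R]_(x in Omega) _ = \int[leb2 R]_(y in Omega) h y).
      by apply: eq_Rintegral => y _; rewrite /h Ed.
    rewrite -EA; apply: eq_Rintegral => x; rewrite inE => Ox.
    by rewrite /h /= GF.
  have L1t : L1 (leb2 R) Omega (fun y => DG m i y * tensor al be y).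
    apply: L2_mul => //; apply: (continuous_L2 oO muO cB OB).
    exact: (Cdir_continuous (Cdir_tensor (Ca 0%N) (Cb 0%N))).
  rewrite E1 in EB; apply: oppr_inj; rewrite -[LHS]EB mulrN; congr (- _).
  rewrite -RintegralZl //; apply: eq_Rintegral => y _.
  by rewrite mulrA [RHS]mulrC.
have cont (c : R -> R) : Cdir (unitdir R) 0 c -> continuous c by exact: Cdir_continuous.
have [j0|j1] := eqVneq j 0.
  apply: (main al ('D_1 be)) => //; try (by apply: cont).
  - move=> k x; rewrite /sg j0 eqxx.
    by have [_ ->] := wedge_tensor x (Ca 1%N) (Cb 1%N) (c1 k 0) (c1 k 1).
  - by move=> y; rewrite pderiv_tensor // /m j0 eqxx.
have j1' : j = 1 by apply/val_inj; case: j j1 {m sg main} => -[|[|]].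
apply: (main ('D_1 al) be) => //; try (by apply: cont).
- move=> k x; rewrite /sg (negbTE j1) j1'.
  by have [-> _] := wedge_tensor x (Ca 1%N) (Cb 1%N) (c1 k 0) (c1 k 1).
- by move=> y; rewrite pderiv_tensor // /m (negbTE j1) eqxx.
Qed.

(** Over a part [A] of the preimage of [N], the integral of [dx_i' /\ dF_j] is
    the integral of an integrable density over the image of [A], which is a part
    of [N]. So this form vanishes almost everywhere on the preimage; for [i']
    the index other than [i], its coefficient is the [i]-th derivative of [F_j]
    up to sign. *)
Lemma gradient_null_preimage (N : set (plane R)) i j : measurable N ->
  leb2 R N = 0%E ->
  {ae leb2 R, forall x, Omega x -> N (F x) -> P i j x = 0}.
Proof.
move=> mN N0.
pose i' : 'I_2 := if i == 0 then 1 else 0.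
pose w := jac (gradcoord i') (grad j).
have [v v1 same_v] := pushforward_coord_wedge i' j.
have w1 : L1 (leb2 R) Omega w by exact: jac_L1.
pose E := Omega `&` F @^-1` N.
have mE : measurable (E : set (plane R)) by exact: mF.
have EO : E `<=` Omega by move=> x [].
have w1E : (leb2 R).-integrable (E : set (plane R)) (EFin \o w).
  by apply: integrableS w1.
have zero (A : set (plane R)) : A `<=` E -> measurable A -> (\int[leb2 R]_(x in A) (w x)%:E = 0)%E.
  move=> AE mA.
  have w1A : (leb2 R).-integrable A (EFin \o w) by exact: integrableS w1E.
  rewrite -[LHS]fineK; last exact: integrable_fin_num.
  congr (_%:E); rewrite -/(Rintegral (leb2 R) A w).
  (* This is the indicator of the image of [A], written with the inverse map so
     that it is visibly measurable. *)
  pose h y : R := \1_A (G y).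
  have mh : measurable_fun (Omega : set (plane R)) h.
    by apply: measurableT_comp => //; exact: measurable_indic.
  have hC y : Omega y -> `|h y| <= 1.
    by rewrite /h indicE; case: (_ \in _); rewrite /= ?normr1 ?normr0.
  have Sh := same_bounded mO oO mF FO w1 v1 same_v mh hC; rewrite /same_integral in Sh.
  have E1 : \int[leb2 R]_(x in A) w x = \int[leb2 R]_(x in Omega) (h (F x) * w x).
    rewrite -(setIidr (subset_trans AE EO)) Rintegral_mkcondr.
    apply: eq_Rintegral => x; rewrite inE => Ox.
    rewrite /h GF // patchE indicE.
    by case: (x \in A); rewrite /= ?mul1r ?mul0r.
  rewrite E1 Sh.
  have vN : (leb2 R).-integrable (Omega : set (plane R)) (EFin \o (fun y => h y * v y)).
    exact: (L1_mulbounded mO mh hC v1).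
  rewrite /Rintegral (negligible_integral mN mO vN N0).
  rewrite (eq_integral (cst 0%E)) ?integral0 // => y; rewrite inE => -[Oy nNy].
  by rewrite /h /= indicE memNset ?mul0r // => /AE[_]; rewrite /= FG.
have := integral_ae_eq mE w1E (measurable_cst (0%E : \bar R)).
move=> H; have {}H : ae_eq (leb2 R) E (EFin \o w) (cst 0%E).
  by apply: H => A AE mA; rewrite [LHS](zero A AE mA) integral0.
apply: filterS H => x Hx Ox NFx.
have {}Hx := Hx (conj Ox NFx).
have w0 : w x = 0 by case: Hx.
move: w0; rewrite /w /jac /gradcoord /grad /i'.
case: i {i' w w1 w1E zero same_v Hx} => -[|[|//]] p /=.
  by rewrite mul0r sub0r mul1r => /eqP; rewrite oppr_eq0 => /eqP <-; congr (P _ _ _); exact/val_inj.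
by rewrite mul1r mul0r subr0 => <-; congr (P _ _ _); exact/val_inj.
Qed.

(** The approximations differ from the identity by functions with compact
    support, whose derivatives have integral 0. *)
Lemma integral_gradient i j :
  \int[leb2 R]_(x in Omega) P i j x = (i == j)%:R * fine (leb2 R Omega).
Proof.
have d2 n : L2 (leb2 R) Omega (pderiv i (f_ n j)).
  by apply: (continuous_L2 oO muO cB OB); exact: Cdir_continuous (C1_pderiv i (c1 n j)).
have d1 n := L2_L1 mO muO (d2 n).
have lim := cvgL1_int mO d1 (L2_L1 mO muO (P2 i j)) (cvgL2_L1 mO muO d2 (P2 i j) (cP i j)).
suff E n : \int[leb2 R]_(x in Omega) pderiv i (f_ n j) x = (i == j)%:R * fine (leb2 R Omega).
  by rewrite (funext E) in lim; exact: (esym (cvg_unique _ (cvg_cst _) lim)).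
have Cp : Cdir (basis2 R) 1 (f_ n j \- pcoord j) by apply: CdirB => //; exact: Cdir_pcoord.
have E0 : \int[leb2 R]_(x in Omega) pderiv i (f_ n j \- pcoord j) x = 0.
  have cKn : compact (K n) by exact: cK.
  refine (integral_pderiv0 i Cp cKn (KO (n := n)) _) => x nK /=.
  by rewrite fK // subrr.
have := E0; rewrite (_ : Rintegral _ _ _ =
  \int[leb2 R]_(x in Omega) (pderiv i (f_ n j) x - cst (j == i)%:R x)); last first.
  by apply: eq_Rintegral => x _; rewrite (pderivB i x (c1 n j) (@Cdir_pcoord R 1 j)) pderiv_pcoord.
rewrite (RintegralB mO (d1 n) (L1_cst mO muO (j == i)%:R)).
by move=> /eqP; rewrite subr_eq0 eq_sym Rintegral_cst // => /eqP <-; rewrite eq_sym.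
Qed.

End change_of_variables.

(** * Weak gradients *)

Lemma ae_mono (R : realType) (P Q : plane R -> Prop) : (forall x, P x -> Q x) ->
  {ae leb2 R, forall x, P x} -> {ae leb2 R, forall x, Q x}.
Proof. by move=> PQ aP; apply: (@filterS _ _ _ P Q PQ aP). Qed.

Lemma ae_mono2 (R : realType) (P Q S : plane R -> Prop) : (forall x, P x -> Q x -> S x) ->
  {ae leb2 R, forall x, P x} -> {ae leb2 R, forall x, Q x} ->
  {ae leb2 R, forall x, S x}.
Proof. by move=> PQS aP aQ; apply: (@filterS2 _ _ _ P Q S PQS aP aQ). Qed.

Lemma ae_I2 (R : realType) (Q : 'I_2 -> plane R -> Prop) :
  (forall i, {ae leb2 R, forall x, Q i x}) -> {ae leb2 R, forall x, forall i, Q i x}.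
Proof.
move=> aQ; apply: (ae_mono2 _ (aQ 0) (aQ 1)) => x Q0 Q1 i.
have [->//|i1] := eqVneq i 0.
by have -> : i = 1 by apply/val_inj; case: i i1 => -[|[|]].
Qed.

Lemma ae_Rintegral0 (R : realType) (D : set (plane R)) (w : plane R -> R) :
  measurable D -> measurable_fun D w ->
  {ae leb2 R, forall x, D x -> w x = 0} -> \int[leb2 R]_(x in D) w x = 0.
Proof.
move=> mD mw w0; rewrite /Rintegral (ae_eq_integral (cst 0%E)) ?integral0 //.
  exact/measurable_EFinP.
by apply: ae_mono w0 => x H Dx; rewrite /= H.
Qed.

Section sobolev.
Context (R : realType) (Omega B : set (R * R)).
Hypotheses (oO : open Omega) (muO : (leb2 R Omega < +oo)%E)
  (cB : compact B) (OB : Omega `<=` B).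

Let mO : measurable (Omega : set (plane R)).
Proof. exact: open_measurable2. Qed.

Lemma Lnorm_on_sqr (u : R * R -> R) :
  (Lnorm_on Omega 2%:E u `^ 2 = \int[leb2 R]_(x in Omega) (u x ^+ 2)%:E)%E.
Proof.
rewrite /Lnorm_on poweR_Lnorm ?pnatr_eq0 // [RHS]integral_mkcond.
apply: eq_integral => x _.
transitivity ((`|(u \_ Omega) x| `^ 2)%:E); first by [].
rewrite powR_mulrn ?normr_ge0 // real_normK ?num_real // !patchE.
by case: ifP => //; rewrite expr0n.
Qed.

Lemma Lp_on_L2 (u : R * R -> R) : Lp_on Omega 2%:E u -> L2 (leb2 R) Omega u.
Proof.
move=> [mu nu]; split=> //; apply/integrableP; split.
  exact/measurable_EFinP/measurable_funX.
under eq_integral do rewrite /= ger0_norm ?sqr_ge0 //.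
by rewrite -Lnorm_on_sqr poweR_lty.
Qed.

Lemma cvgL2_Lnorm_on (u_ : nat -> R * R -> R) u :
  (fun n => Lnorm_on Omega 2%:E (fun x => u_ n x - u x)) @ \oo --> 0%E ->
  cvgL2 (leb2 R) Omega u_ u.
Proof.
move=> /fine_cvg; rewrite /cvgL2.
set N := fun n : nat => _ => N0.
have E n : \int[leb2 R]_(x in Omega) (u_ n x - u x) ^+ 2 = fine (N n) ^+ 2.
  rewrite /Rintegral -Lnorm_on_sqr -/(N n).
  have : (0 <= N n)%E by exact: Lnorm_ge0.
  case: (N n) => [r r0|_|//] /=; first by rewrite powR_mulrn.
  by rewrite pnatr_eq0 expr0n.
rewrite (funext E) -[X in _ --> X](mulr0 0).
under eq_fun do rewrite expr2.
exact: cvgM.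
Qed.

(** This is [same_bounded] for the identity map, with [w] as density on one side
    and 0 on the other. *)
Lemma ae_eq0_test_function (w : R * R -> R) : L1 (leb2 R) Omega w ->
  (forall phi, test_function Omega phi -> \int[leb2 R]_(x in Omega) (phi x * w x) = 0) ->
  {ae leb2 R, forall x, Omega x -> w x = 0}.
Proof.
move=> w1 w0; have v1 : L1 (leb2 R) Omega (cst (0 : R)) by exact: L1_cst.
have int0 (h : R * R -> R) : \int[leb2 R]_(y in Omega) (h y * cst 0 y) = 0.
  transitivity (\int[leb2 R]_(y in Omega) (0 : R)).
    by apply: eq_Rintegral => y _; rewrite mulr0.
  by rewrite Rintegral_cst // mul0r.
have mid : measurable_fun (Omega : set (plane R)) (id : plane R -> plane R) by [].
have same n a b a' b' : crect ((a, b), (a', b')) `<=` Omega ->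
    same_integral (leb2 R) Omega Omega id w (cst 0)
      (fun y => plateau n a b y.1 * plateau n a' b' y.2).
  move=> qO; rewrite /same_integral int0 -[RHS](w0 _ (test_tensor n qO)) //.
have zero (A : set (plane R)) : A `<=` Omega -> measurable A ->
    (\int[leb2 R]_(x in A) (w x)%:E = 0)%E.
  move=> AO mA.
  have w1A : (leb2 R).-integrable A (EFin \o w) by exact: integrableS w1.
  rewrite -[LHS]fineK; last exact: integrable_fin_num.
  congr (_%:E); rewrite -/(Rintegral (leb2 R) A w).
  have mh : measurable_fun (Omega : set (plane R)) (\1_A : _ -> R) by exact: measurable_indic.
  have hC y : Omega y -> `|\1_A y : R| <= 1.
    by rewrite indicE; case: (_ \in _); rewrite /= ?normr1 ?normr0.
  have Sh := same_bounded mO oO mid (fun _ => id) w1 v1 same mh hC.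
  rewrite /same_integral int0 in Sh; rewrite -[RHS]Sh.
  rewrite -(setIidr AO) Rintegral_mkcondr.
  apply: eq_Rintegral => x; rewrite inE => Ox.
  rewrite patchE indicE (setIidr AO).
  by case: (x \in A); rewrite /= ?mul1r ?mul0r.
have H := integral_ae_eq mO w1 (measurable_cst (0%E : \bar R)).
have {}H : ae_eq (leb2 R) Omega (EFin \o w) (cst 0%E).
  by apply: H => A AO mA; rewrite [LHS](zero A AO mA) integral0.
by apply: filterS H => x Hx Ox; case: (Hx Ox).
Qed.

(** Weak gradients are unique. This identifies the gradient by which the
    pushforward is defined with the one that the approximation of [F_j - x_j] by
    test functions provides. *)
Lemma weak_gradient_sub_coord j (u : R * R -> R) (g h : 'I_2 -> R * R -> R) :
  L2 (leb2 R) Omega u -> weak_gradient Omega u h ->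
  weak_gradient Omega (fun x => u x - pcoord j x) g ->
  forall i, {ae leb2 R, forall x, Omega x -> h i x = (i == j)%:R + g i x}.
Proof.
move=> u2 wh wg i.
have [/Lp_on_L2 g2 Eg] := wg i; have [/Lp_on_L2 h2 Eh] := wh i.
have w2 : L2 (leb2 R) Omega (fun x => h i x - ((i == j)%:R + g i x)).
  apply: L2B => //; apply: (L2D mO _ g2); exact: L2_cst.
suff : {ae leb2 R, forall x, Omega x -> h i x - ((i == j)%:R + g i x) = 0}.
  by apply: ae_mono => x H Ox; apply/eqP; rewrite -subr_eq0 H.
apply: (ae_eq0_test_function (L2_L1 mO muO w2)) => phi tphi.
have [Cphi [K [cK KO phi0]]] := tphi.
have Cp k : Cdir (basis2 R) k phi by exact/CkE.
have phi2 : L2 (leb2 R) Omega phi.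
  by apply: (continuous_L2 oO muO cB OB); exact: Cdir_continuous (Cp 0%N).
have dphi2 : L2 (leb2 R) Omega (pderiv i phi).
  by apply: (continuous_L2 oO muO cB OB); exact: Cdir_continuous (C1_pderiv i (Cp 1%N)).
have x2 : L2 (leb2 R) Omega (pcoord j).
  by apply: (continuous_L2 oO muO cB OB); exact: pcoord_continuous.
have ibp : \int[leb2 R]_(x in Omega) (pcoord j x * pderiv i phi x) +
    \int[leb2 R]_(x in Omega) ((i == j)%:R * phi x) = 0.
  have Cxp : Cdir (basis2 R) 1 (pcoord j \* phi).
    by apply: CdirM => //; exact: Cdir_pcoord.
  rewrite -RintegralD //; [|exact: L2_mul|by apply: L1Z => //; exact: L2_L1].
  have := @integral_pderiv0 _ _ K Omega i Cxp cK KO.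
  move=> <-; last by move=> x /phi0 /= ->; rewrite mulr0.
  apply: eq_Rintegral => x _; rewrite (pderivM i x (@Cdir_pcoord R 1 j) (Cp 1%N)).
  by rewrite pderiv_pcoord /= eq_sym mulrC [X in _ + X]mulrC.
have := Eg phi tphi.
rewrite (_ : \int[leb2 R]_(x in Omega) ((u x - pcoord j x) * pderiv i phi x) =
   \int[leb2 R]_(x in Omega) (u x * pderiv i phi x - pcoord j x * pderiv i phi x)); last first.
  by apply: eq_Rintegral => x _; rewrite mulrBl.
rewrite RintegralB //; [|exact: L2_mul|exact: L2_mul].
rewrite (Eh phi tphi) => Eg'.
rewrite (_ : \int[leb2 R]_(x in Omega) _ =
  \int[leb2 R]_(x in Omega) ((h i x * phi x - (i == j)%:R * phi x) - g i x * phi x)); last first.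
  by apply: eq_Rintegral => x _; ring.
have hp := L2_mul mO h2 phi2; have gp := L2_mul mO g2 phi2.
have dp : L1 (leb2 R) Omega (fun x => (i == j)%:R * phi x) by apply: L1Z => //; exact: L2_L1.
rewrite RintegralB //; last exact: L1B.
rewrite RintegralB //.
move: ibp Eg'.
move: (Rintegral _ _ _) (Rintegral _ _ _) (Rintegral _ _ _) (Rintegral _ _ _) => *.
lra.
Qed.

End sobolev.

(** * Conformal matrices *)

Section conformal.
Context (R : realType).

Lemma det_mx2 (M : 'M[R]_2) : \det M = M 0 0 * M 1 1 - M 0 1 * M 1 0.
Proof.
have l00 : lift 0 0 = 1 :> 'I_2 by exact/val_inj.
have l10 : lift 1 0 = 0 :> 'I_2 by exact/val_inj.
rewrite (expand_det_row _ 0) !big_ord_recl big_ord0 addr0 /cofactor !det_mx11 !mxE /=.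
rewrite -![@ord0 1]/(0 : 'I_2) -![@ord0 0]/(0 : 'I_1) !l00 !l10 /bump /=.
by rewrite expr0 mul1r expr1 mulN1r mulrN.
Qed.

Lemma mulmx_congr2 (M S : 'M[R]_2) i j : (M^T *m S *m M) i j =
  M 0 i * S 0 0 * M 0 j + M 1 i * S 1 0 * M 0 j +
  (M 0 i * S 0 1 * M 1 j + M 1 i * S 1 1 * M 1 j).
Proof.
have l00 : lift 0 0 = 1 :> 'I_2 by exact/val_inj.
rewrite !mxE !big_ord_recl !big_ord0 !addr0 !mxE !big_ord_recl !big_ord0 !addr0 !mxE.
by rewrite -![@ord0 1]/(0 : 'I_2) -![@ord0 0]/(0 : 'I_1) !l00 !mulrDl.
Qed.

(** Here [(p, q)] and [(r, t)] are the columns of a matrix [M] and [a], [b], [c]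
    are the entries of the symmetric matrix [sigma], with [M^T sigma M] equal to
    [g * det M] times the identity. Determinants give [g = s]. Then the sum of
    the squares of the left-hand sides of the two equations is [a] times the
    trace of [M^T sigma M], minus [2 * a * s * det M], which is 0. *)
Lemma cauchy_riemann_real (a b c s g p q r t : R) : 0 < a -> 0 <= s -> 0 < g ->
  s ^+ 2 = a * c - b ^+ 2 -> p * t - r * q != 0 ->
  a * p ^+ 2 + 2 * b * p * q + c * q ^+ 2 = g * (p * t - r * q) ->
  a * r ^+ 2 + 2 * b * r * t + c * t ^+ 2 = g * (p * t - r * q) ->
  a * p * r + b * (p * t + q * r) + c * q * t = 0 ->
  a * p + b * q - s * t = 0 /\ a * r + b * t + s * q = 0.
Proof.
move=> a0 s0 g0 ss D0 E0 E1 E01; set D := p * t - r * q in D0 E0 E1.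
have gs : g = s.
  apply/eqP; rewrite -(@eqrXn2 _ 2 g s isT (ltW g0) s0) ss.
  have D2 : D ^+ 2 != 0 by rewrite expf_neq0.
  apply/eqP; apply: (mulIf D2).
  have -> : g ^+ 2 * D ^+ 2 = (g * D) * (g * D) - 0 ^+ 2 by ring.
  by rewrite -[in LHS]E01 -[X in X * _]E0 -E1 /D; ring.
have sq : (a * p + b * q - s * t) ^+ 2 + (a * r + b * t + s * q) ^+ 2 = 0.
  rewrite (_ : _ + _ = a * ((a * p ^+ 2 + 2 * b * p * q + c * q ^+ 2) +
     (a * r ^+ 2 + 2 * b * r * t + c * t ^+ 2)) - 2 * a * s * D +
     (s ^+ 2 - (a * c - b ^+ 2)) * (q ^+ 2 + t ^+ 2)); last by rewrite /D; ring.
  by rewrite E0 E1 gs ss; ring.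
move: sq => /eqP; rewrite paddr_eq0 ?sqr_ge0 // !sqrf_eq0 => /andP[/eqP -> /eqP ->].
by [].
Qed.

Lemma cauchy_riemann (S M : 'M[R]_2) (g : R) : S^T = S ->
  0 < S 0 0 -> 0 <= S 0 0 * S 1 1 - S 0 1 ^+ 2 -> 0 < g ->
  (\det M)^-1 *: (M^T *m S *m M) = g%:M ->
  let s := Num.sqrt (S 0 0 * S 1 1 - S 0 1 ^+ 2) in
  S 0 0 * M 0 0 + S 0 1 * M 1 0 - s * M 1 1 = 0 /\
  S 0 0 * M 0 1 + S 0 1 * M 1 1 + s * M 1 0 = 0.
Proof.
move=> St S0 S1 g0 E s.
have S10 : S 1 0 = S 0 1 by rewrite -[in LHS]St mxE.
have D0 : \det M != 0.
  apply/eqP => D0; have := congr1 (fun A : 'M[R]_2 => A 0 0) E.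
  by rewrite !mxE D0 invr0 mul0r eqxx mulr1n => /esym /eqP; rewrite gt_eqF.
have {}E : M^T *m S *m M = (g * \det M)%:M.
  by rewrite mulrC -scale_scalar_mx -E scalerA mulfV // scale1r.
have Eij i j : (M^T *m S *m M) i j = (g * \det M) *+ (i == j) by rewrite E mxE.
rewrite det_mx2 in D0.
have E00 := Eij 0 0; have E11 := Eij 1 1; have E01 := Eij 0 1.
rewrite mulmx_congr2 det_mx2 S10 /= mulr1n in E00.
rewrite mulmx_congr2 det_mx2 S10 /= mulr1n in E11.
rewrite mulmx_congr2 S10 /= mulr0n in E01.
apply: (@cauchy_riemann_real (S 0 0) (S 0 1) (S 1 1) s g) => //.
- exact: sqrtr_ge0.
- exact: sqr_sqrtr.
- by rewrite -E00; ring.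
- by rewrite -E11; ring.
- by rewrite -[RHS]E01; ring.
Qed.

Lemma qform_scalar (k : R) (xi : 'cV[R]_2) : qform k%:M xi = k * qform 1%:M xi.
Proof. by rewrite /qform mul_mx_scalar -scalemxAl mxE mulmx1. Qed.

Lemma posdef2 (S : 'M[R]_2) : S^T = S -> posdef S ->
  0 < S 0 0 /\ 0 <= S 0 0 * S 1 1 - S 0 1 ^+ 2.
Proof.
move=> St pS.
have S10 : S 1 0 = S 0 1 by rewrite -[in LHS]St mxE.
have l00 : lift 0 0 = 1 :> 'I_2 by exact/val_inj.
have qE (x y : R) : qform S (\col_i (if i == 0 then x else y)) =
    S 0 0 * x ^+ 2 + 2 * S 0 1 * x * y + S 1 1 * y ^+ 2.
  rewrite /qform !mxE !big_ord_recl !big_ord0 !addr0 !mxE !big_ord_recl !big_ord0 !addr0 !mxE.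
  by rewrite -![@ord0 1]/(0 : 'I_2) !l00 /= S10; ring.
have nz (x y : R) : x != 0 -> (\col_i (if i == 0 then x else y) : 'cV[R]_2) != 0.
  move=> x0; apply/eqP => /(congr1 (fun A : 'cV[R]_2 => A 0 0)).
  by rewrite !mxE /= => /eqP; rewrite (negbTE x0).
have nz' (x y : R) : y != 0 -> (\col_i (if i == 0 then x else y) : 'cV[R]_2) != 0.
  move=> x0; apply/eqP => /(congr1 (fun A : 'cV[R]_2 => A 1 0)).
  by rewrite !mxE /= => /eqP; rewrite (negbTE x0).
have a0 : 0 < S 0 0.
  have := pS _ (nz 1 0 (oner_neq0 _)); rewrite qE.
  by rewrite expr1n mulr1 mulr0 expr0n mulr0 !addr0.
split=> //; apply: ltW.
have := pS _ (nz' (- S 0 1) (S 0 0) (lt0r_neq0 a0)); rewrite qE.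
rewrite (_ : _ + _ = S 0 0 * (S 0 0 * S 1 1 - S 0 1 ^+ 2)); last by ring.
by rewrite pmulr_rgt0.
Qed.

End conformal.

(** * Isotropic images of a constant matrix *)

Section domain.
Context (R : realType) (Omega : set (R * R)).

Lemma bounded_crect : bounded_set Omega ->
  exists q : (R * R) * (R * R), Omega `<=` crect q.
Proof.
move=> [M [_ HM]]; pose r := `|M| + 1.
exists ((- r, r), (- r, r)) => x Ox.
have : `|x| <= r by apply: HM => //; rewrite (le_lt_trans (ler_norm _)) // ltrDl.
rewrite [`|x|]/Num.norm /= ge_max => /andP[a b].
by split; rewrite /= in_itv /= -ler_norml.
Qed.

Lemma leb2_open_gt0 : open Omega -> Omega !=set0 -> (0 < leb2 R Omega)%E.
Proof.
move=> oO [x Ox]; have mO := open_measurable2 oO.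
have [q [_ OE]] := open_orect_cover oO.
have [n _ xq] : (\bigcup_n orect (q n)) x by rewrite -OE.
have qO : orect (q n) `<=` Omega by rewrite OE => y yq; exists n.
have mq := measurable_orect (q n).
apply: (@lt_le_trans _ _ (leb2 R (orect (q n)))); last by apply: le_measure; rewrite ?inE.
move: xq => [] /=; rewrite !in_itv /= => /andP[a1 a2] /andP[b1 b2].
have pos (a b t : R) : a < t -> t < b -> (0 < (@lebesgue_measure R) `]a, b[%classic)%E.
  move=> at_ tb; rewrite lebesgue_measure_itv /= lte_fin (lt_trans at_ tb).
  by rewrite -EFinB lte_fin subr_gt0 (lt_trans at_ tb).
rewrite /orect product_measure1E; [|exact: measurable_itv..].
by apply: mule_gt0; [exact: (pos _ _ x.1)|exact: (pos _ _ x.2)].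
Qed.

End domain.

Theorem proposition6p2 (R : realType) (Omega : set (R * R))
    (Omega_open : open Omega) (Omega_neq0 : Omega !=set0)
    (Omega_bounded : bounded_set Omega) (Omega_convex : convex_set Omega)
    (Omega_C2 : C2_boundary Omega)
    (sigma : 'M[R]_2) (sigma_sym : sigma^T = sigma)
    (sigma_pos : posdef sigma)
    (sigma_niso : ~ isotropic Omega (cst sigma)) :
  ~ exists gamma : R * R -> 'M[R]_2,
      E_class Omega (cst sigma) gamma /\ isotropic Omega gamma.
Proof.
move=> [gamma [[[_ _ [lam [Lam [lam0 ell]]]] [F [DF [dF bF wF pF]]]] [al iso]]].
have [q Oq] := bounded_crect Omega_bounded.
have cB := crect_compact (q := q).
have mO := open_measurable2 Omega_open.
have muO : (leb2 R Omega < +oo)%E.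
  apply: le_lt_trans (leb2_crect_fin q); apply: le_measure => //; rewrite inE //.
  by apply: measurableX; exact: measurable_itv.
have [bij _ _ F1 G1] := dF.
have [FO Finj Fsurj] := bij.
pose G := pinv Omega F.
have GF x : Omega x -> G (F x) = x.
  by move=> Ox; rewrite /G (pinvKV _ Finj) // inE.
have FG y : Omega y -> F (G y) = y.
  by move=> Oy; apply: pinvK; rewrite inE; exact: Fsurj.
have GO y : Omega y -> Omega (G y).
  by move=> /Fsurj[x Ox <-]; rewrite GF.
have F2 j : L2 (leb2 R) Omega (pcoord j \o F) by apply: Lp_on_L2 => //; have [] := F1 j.
have mG j : measurable_fun (Omega : set (plane R)) (pcoord j \o G).
  by have [[]] := G1 j.
have /choice[DG wG] j : exists g, weak_gradient Omega (pcoord j \o G) g by have [] := G1 j.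
(* [gphi j] consists of the weak gradient of [F_j - x_j] and of the test
   functions that converge to [F_j - x_j]. *)
have /choice[gphi Hgphi] j : exists gphi : ('I_2 -> R * R -> R) * (nat -> R * R -> R),
   [/\ weak_gradient Omega (fun x => pcoord j (F x) - pcoord j x) gphi.1,
     forall n, test_function Omega (gphi.2 n),
     Lnorm_on Omega 2%:E (fun x => gphi.2 n x - (pcoord j (F x) - pcoord j x)) @[n --> \oo] --> 0%E &
     forall i, Lnorm_on Omega 2%:E (fun x => pderiv i (gphi.2 n) x - gphi.1 i x) @[n --> \oo] --> 0%E].
  by have [_ [g wg [phi [t c1 c2]]]] := bF j; exists (g, phi).
pose g j := (gphi j).1; pose phi j := (gphi j).2.
pose f_ n j := @pcoord R j \+ phi j n.
pose P (i j : 'I_2) x := (i == j)%:R + g j i x.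
have Cphi n j k : Cdir (basis2 R) k (phi j n) by have [_ /(_ n)[C _] _ _] := Hgphi j; exact/CkE.
have Cf n j k : Cdir (basis2 R) k (f_ n j).
  by apply: CdirD => //; exact: Cdir_pcoord.
have /choice[K HK] n : exists K : set (R * R), [/\ compact K, K `<=` Omega &
    forall j x, ~ K x -> f_ n j x = pcoord j x].
  have [_ /(_ n)[_ [K0 [cK0 K0O p0]]] _ _] := Hgphi 0.
  have [_ /(_ n)[_ [K1 [cK1 K1O p1]]] _ _] := Hgphi 1.
  exists (K0 `|` K1); split; [exact: compactU|by rewrite subUset|].
  move=> j x /not_orP[n0 n1]; rewrite /f_ /phi /=.
  have [->|j1] := eqVneq j 0; first by rewrite p0 // addr0.
  have -> : j = 1 by apply/val_inj; case: j j1 => -[|[|]].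
  by rewrite p1 // addr0.
have cK n : compact (K n) by have [] := HK n.
have KO n : K n `<=` Omega by have [] := HK n.
have fK n j x : ~ K n x -> f_ n j x = pcoord j x by have [_ _] := HK n; apply.
have DG2 m i : L2 (leb2 R) Omega (DG i m) by apply: Lp_on_L2 => //; have [] := wG i m.
have wG' m i psi : test_function Omega psi ->
    \int[leb2 R]_(y in Omega) ((pcoord i \o G) y * pderiv m psi y) =
    - \int[leb2 R]_(y in Omega) (DG i m y * psi y) by have [_] := wG i m; apply.
have g2 j i : L2 (leb2 R) Omega (g j i) by apply: Lp_on_L2 => //; have [/(_ i)[]] := Hgphi j.
have P2 i j : L2 (leb2 R) Omega (P i j) by apply: L2D => //; exact: L2_cst.
have cF j : cvgL2 (leb2 R) Omega (fun n => f_ n j) (pcoord j \o F).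
  apply: cvgL2_Lnorm_on => //; have [_ _ H _] := Hgphi j.
  apply: cvg_trans H; apply: near_eq_cvg; apply: nearW => n.
  congr Lnorm_on; apply/funext => x; rewrite /f_ /phi /=; ring.
have cP i j : cvgL2 (leb2 R) Omega (fun n => pderiv i (f_ n j)) (P i j).
  apply: cvgL2_Lnorm_on => //; have [_ _ _ /(_ i) H] := Hgphi j.
  apply: cvg_trans H; apply: near_eq_cvg; apply: nearW => n.
  congr Lnorm_on; apply/funext => x; rewrite /P /f_ /g /pderiv.
  have dc : derivable (@pcoord R j) x (basis2 R i) by have [] := derive_pcoord j x (basis2 R i).
  have dp : derivable (phi j n) x (basis2 R i) by exact: (C1_derivable (Cphi n j 1%N)).
  have -> : 'D_(basis2 R i) (pcoord j \+ phi j n) x = (j == i)%:R + pderiv i (phi j n) x.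
    by rewrite -[RHS](congr1 (fun h => h x + _) (pderiv_pcoord R j i)); exact: (deriveD dc dp).
  by rewrite [j == i]eq_sym /phi /pderiv; ring.
have DFP j i : {ae leb2 R, forall x, Omega x -> DF x i j = P i j x}.
  have [wg _ _ _] := Hgphi j.
  exact: (weak_gradient_sub_coord Omega_open muO cB Oq (F2 j) (wF j) wg).
have [S0 S1] := posdef2 sigma_sym sigma_pos.
set a := sigma 0 0 in S0 S1; set b := sigma 0 1 in S1; set c := sigma 1 1 in S1.
pose s := Num.sqrt (a * c - b ^+ 2).
(* The scalar [k] is positive by ellipticity, which turns the isotropy of
   [gamma] into the hypothesis of [cauchy_riemann] at the preimage of [y]. *)
pose good y := exists2 k : R, 0 < k &
  (\det (DF (G y)))^-1 *: ((DF (G y))^T *m sigma *m DF (G y)) = k%:M.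
have [N [mN N0 subN]] : (leb2 R).-negligible (~` [set y | Omega y -> good y]).
  have gY : {ae leb2 R, forall y, Omega y -> gamma y = (al y)%:M /\ lam <= al y}.
    apply: (ae_mono2 _ iso ell) => y gy ey Oy; have gyy := gy Oy; split=> //.
    have /andP[+ _] := ey Oy (\col_i 1).
    have q0 : 0 < qform 1%:M (\col_(i < 2) (1 : R)).
      by rewrite /qform mulmx1 !mxE !big_ord_recl big_ord0 addr0 !mxE mulr1 addr_gt0.
    by rewrite gyy [X in _ <= X]qform_scalar ler_pM2r.
  apply: (ae_mono2 _ gY pF) => y gy py Oy; have [gy1 gy2] := gy Oy.
  exists (al y); first exact: lt_le_trans gy2.
  by rewrite -gy1 (py Oy).
have CR : {ae leb2 R, forall x, Omega x ->
    a * P 0 0 x + b * P 1 0 x - s * P 1 1 x = 0 /\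
    a * P 0 1 x + b * P 1 1 x + s * P 1 0 x = 0}.
  have null i j := gradient_null_preimage Omega_open muO cB Oq Cf cK KO fK F2 P2 cF cP
    FO GO GF FG mG DG2 wG' i j mN N0.
  have /ae_I2 DFP2 j := ae_I2 (DFP j).
  have /ae_I2 null2 i := ae_I2 (null i).
  apply: (ae_mono2 _ DFP2 null2) => x DFx nullx Ox.
  (* The preimage of the exceptional set may have positive measure, but there
     the equations hold because the gradient is 0. *)
  have [NFx|nNFx] := pselect (N (F x)).
    by rewrite !(nullx _ _ Ox NFx) !mulr0 !addr0 subr0.
  have /(_ (FO _ Ox))[k k0 Ek] : Omega (F x) -> good (F x).
    by apply: contrapT => ng; apply: nNFx; exact: subN.
  rewrite GF // in Ek.
  by have := cauchy_riemann sigma_sym S0 S1 k0 Ek; rewrite !(DFx _ _ Ox).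
have P1 i j : L1 (leb2 R) Omega (P i j) by exact: L2_L1.
have m0 : 0 < fine (leb2 R Omega).
  by apply: fine_gt0; rewrite leb2_open_gt0.
have intP i j := integral_gradient Omega_open muO cB Oq Cf cK KO fK P2 cP i j.
have lin k1 k2 k3 (u v w : R * R -> R) :
    L1 (leb2 R) Omega u -> L1 (leb2 R) Omega v -> L1 (leb2 R) Omega w ->
    {ae leb2 R, forall x, Omega x -> k1 * u x + k2 * v x + k3 * w x = 0} ->
    k1 * \int[leb2 R]_(x in Omega) u x + k2 * \int[leb2 R]_(x in Omega) v x +
    k3 * \int[leb2 R]_(x in Omega) w x = 0.
  move=> u1 v1 w1 H.
  have i1 := L1Z mO k1 u1; have i2 := L1Z mO k2 v1; have i3 := L1Z mO k3 w1.
  rewrite -(RintegralZl k1 mO u1) -(RintegralZl k2 mO v1) -(RintegralZl k3 mO w1).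
  rewrite -(RintegralD mO i1 i2) -(RintegralD mO (L1D mO i1 i2) i3).
  by apply: ae_Rintegral0 => //; exact: L1_measurable (L1D mO (L1D mO i1 i2) i3).
(* Integration replaces [P] by the identity matrix in the twisted
   Cauchy-Riemann equations. *)
have E1 : (a - s) * fine (leb2 R Omega) = 0.
  have := lin a b (- s) _ _ _ (P1 0 0) (P1 1 0) (P1 1 1).
  rewrite !intP /= !mul1r mul0r mulr0 addr0 mulNr -mulrBl; apply.
  by apply: ae_mono CR => x H /H[E _]; rewrite mulNr.
have E2 : b * fine (leb2 R Omega) = 0.
  have := lin a b s _ _ _ (P1 0 1) (P1 1 1) (P1 1 0).
  rewrite !intP /= !mul1r !mul0r !mulr0 addr0 add0r; apply.
  by apply: ae_mono CR => x H /H[_ E].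
have as_ : a = s.
  by apply/eqP; rewrite -subr_eq0; move/eqP: E1; rewrite mulf_eq0 (gt_eqF m0) orbF.
have b0 : b = 0 by move/eqP: E2; rewrite mulf_eq0 (gt_eqF m0) orbF => /eqP.
have ac : a = c.
  have := sqr_sqrtr S1; rewrite -/s -as_ b0 expr0n subr0 expr2.
  by move=> /(mulfI (lt0r_neq0 S0)).
apply: sigma_niso; exists (cst a); apply: aeW => x _ /=.
apply/matrixP => i j; rewrite mxE.
have S10 : sigma 1 0 = b by rewrite -sigma_sym mxE.
have ord2 (k : 'I_2) : k = 0 \/ k = 1.
  by case: k => -[|[|//]] p; [left|right]; exact/val_inj.
by have [->|->] := ord2 i; have [->|->] := ord2 j;
  rewrite ?S10 -/a -/b -/c ?b0 -?ac ?eqxx ?mulr1n ?mulr0n.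
Qed.
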